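(* Let $(\bar u,\bar y,\bar p,\bar\mu)$ be a solution of the first order system (S) given in the context. Suppose that there exists an interval $I\subset\mathbb{R}$ such that $y\mapsto\phi(x,y)$ is convex (respectively, concave) on $I$ for almost all $x\in\Omega$. Furthermore, assume that for every $u\in U_{ad}$ whose state $y=\mathcal G(u)$ satisfies $y_a\le y\le y_b$ in $K$, one has $y(x)\in I$ for all $x\in\Omega$. If $\bar p\le 0$ (respectively, $\bar p\ge 0$) a.e. on $\Omega$, then $\bar u$ is the unique global minimum of $(\mathbb{P})$.
   Context: Setting. $\Omega\subset\mathbb{R}^d$ ($d=2,3$) is a bounded, convex polygonal/polyhedral domain. $\phi:\bar\Omega\times\mathbb{R}\to\mathbb{R}$ is a Carathéodory function with $\phi(x,0)=0$ a.e. in $\Omega$ such that, for almost all $x\in\Omega$, $y\mapsto\phi(x,y)$ is of class $C^1$ with $\phi_y(x,y)\ge 0$; and for every $L\ge 0$ there is $c_L\ge 0$ with $\phi_y(x,y)\le c_L$ for almost all $x\in\Omega$ and all $|y|\le L$. Under these conditions, for every $u\in L^2(\Omega)$ the problem $-\Delta y+\phi(\cdot,y)=u$ in $\Omega$, $y=0$ on $\partial\Omega$, has a unique solution $y=:\mathcal G(u)\in H^2(\Omega)\cap H^1_0(\Omega)$. $U_{ad}:=\{v\in L^2(\Omega): u_a\le v(x)\le u_b \text{ a.e. in }\Omega\}$ with $-\infty\le u_a\le u_b\le\infty$ constants. Let $y_0\in L^2(\Omega)$, $\alpha>0$. $K\subset\bar\Omega$ is compact and either $K\subset\Omega$ (possibly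 empty) or $K=\bar\Omega$; $y_a,y_b\in C^0(\bar\Omega)$ satisfy $y_a(x)<y_b(x)$ for all $x\in K$, and if $K=\bar\Omega$ additionally $y_a(x)<0<y_b(x)$ for $x\in\partial\Omega$. $\mathcal M(K)$ is the space of regular Borel measures on $K$. Problem $(\mathbb{P})$: minimize $J(u):=\frac12\|y-y_0\|_{L^2(\Omega)}^2+\frac{\alpha}{2}\|u\|_{L^2(\Omega)}^2$ over $u\in U_{ad}$ subject to $y=\mathcal G(u)$ and $y_a(x)\le y(x)\le y_b(x)$ for all $x\in K$. First order system (S) for $\bar u\in U_{ad}$, $\bar y\in H^2(\Omega)\cap H^1_0(\Omega)$, $\bar p\in L^2(\Omega)$, $\bar\mu\in\mathcal M(K)$: (i) $\int_\Omega\nabla\bar y\cdot\nabla v+\phi(\cdot,\bar y)v\,dx=\int_\Omega\bar u v\,dx$ for all $v\in H^1_0(\Omega)$, and $y_a\le\bar y\le y_b$ in $K$; (ii) $\int_\Omega\bar p(-\Delta v)+\phi_y(\cdot,\bar y)\bar p\,v\,dx=\int_\Omega(\bar y-y_0)v\,dx+\int_K v\,d\bar\mu$ for all $v\in H^1_0(\Omega)\cap H^2(\Omega)$; (iii) $\int_\Omega(\bar p+\alpha\bar u)(u-\bar u)\,dx\ge 0$ for all $u\in U_{ad}$; (iv) $\int_K(z-\bar y)\,d\bar\mu\le 0$ for all $z\in C^0(K)$ with $y_a\le z\le y_b$ in $K$. *)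

(* Defs.v *)
From HB Require Import structures.
From mathcomp Require Import all_boot all_order all_algebra.
From mathcomp Require Import all_classical all_reals all_analysis.

Set Implicit Arguments.
Unset Strict Implicit.
Unset Printing Implicit Defensive.

Import Order.TTheory GRing.Theory Num.Theory.
Import numFieldNormedType.Exports.

Local Open Scope classical_set_scope.
Local Open Scope ring_scope.

(* Borel sigma-algebra on 'rV[R]_n and n-dimensional Lebesgue measure,
   the latter as an iterated product of the one-dimensional one. *)
Definition borel_rV_display (R : realType) (n : nat) : measure_display.
Proof. exact: default_measure_display. Qed.

Section borel_rV.
Context (R : realType) (n : nat).

Let borel : set (set 'rV[R]_n) := <<s [set A : set 'rV[R]_n | open A] >>.

Let borel0 : borel set0.
Proof. exact: sigma_algebra0. Qed.

Let borelC A : borel A -> borel (~` A).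
Proof. exact: sigma_algebraC. Qed.

Let borelU (F : (set 'rV[R]_n)^nat) :
  (forall i, borel (F i)) -> borel (\bigcup_i F i).
Proof. exact: sigma_algebra_bigcup. Qed.

HB.instance Definition _ := @isMeasurable.Build (borel_rV_display R n)
  'rV[R]_n borel borel0 borelC borelU.

Lemma open_measurable_rV (A : set 'rV[R]_n) : open A -> measurable A.
Proof. by move=> oA; apply: sub_sigma_algebra. Qed.

Lemma measurable_coord (i : 'I_n) :
  measurable_fun setT (fun x : 'rV[R]_n => x 0 i).
Proof.
apply: (measurability _ (measurable_realfun.RGenOpens.measurableE R)).
move=> _ [_ [a [b ->]] <-].
rewrite setTI; apply: open_measurable_rV.
apply: open_comp; last exact: interval_open.
by move=> x _; exact: coord_continuous.
Qed.

Lemma measurable_rVP d (T : measurableType d) (f : T -> 'rV[R]_n) :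
  (forall i, measurable_fun setT (fun x => f x 0 i)) -> measurable_fun setT f.
Proof.
move=> mf; apply: (measurability [set A : set 'rV[R]_n | open A]) => //.
move=> _ [A oA <-]; rewrite setTI.
pose B (q : 'rV[rat]_n * nat) := ball (map_mx ratr q.1 : 'rV[R]_n) q.2.+1%:R^-1.
have -> : f @^-1` A = \bigcup_q (if `[< B q `<=` A >] then f @^-1` B q else set0).
  apply/seteqP; split => [x /= Afx|x [q _]]; last first.
    by case: asboolP => // BA Bx; exact: BA.
  have /nbhs_ballP[e /= e0 eA] := open_nbhs_nbhs (conj oA Afx).
  have [k ke] : exists k : nat, k.+1%:R^-1 < e / 2.
    have [k _ /(_ _ (leqnn k)) hk] := near_infty_natSinv_lt (PosNum (divr_gt0 e0 (ltr0Sn R 1))).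
    by exists k.
  have hq (i : 'I_n) : exists q : rat, `|f x 0 i - ratr q| < k.+1%:R^-1 :> R.
    have : f x 0 i - k.+1%:R^-1 < f x 0 i + k.+1%:R^-1.
      by rewrite ltrD2l (@lt_trans _ _ 0)// ?oppr_lt0 invr_gt0.
    move=> /rat_in_itvoo[q]; rewrite in_itv /= => /andP[h1 h2].
    by exists q; rewrite distrC ltr_distl h1.
  have [q qE] := choice hq.
  have qx : B (\row_i q i, k) (f x).
    split; first by rewrite /= invr_gt0.
    move=> i j; rewrite !mxE /= ord1 /ball /= distrC; exact: qE.
  exists (\row_i q i, k) => //; case: asboolP => // -[] y By.
  apply: eA; apply: (@le_ball _ _ _ (e / 2 + e / 2)); first by rewrite -splitr.
  apply: (@ball_triangle _ _ (map_mx ratr (\row_i q i) : 'rV[R]_n)).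
  - by apply: ball_sym; apply: le_ball qx; exact: ltW.
  - by apply: le_ball By; exact: ltW.
apply: countable_bigcupT_measurable => [|q]; first exact: countableP.
case: ifP => // _.
have -> : f @^-1` B q = \bigcap_(i in [set: 'I_n])
    ((fun x => f x 0 i) @^-1` ball (ratr (q.1 0 i) : R) q.2.+1%:R^-1).
  apply/seteqP; split => [x [_ h] i _|x h].
    by have := h 0 i; rewrite mxE.
  split; first by rewrite invr_gt0.
  by move=> i j; rewrite ord1 mxE; exact: h.
apply: fin_bigcap_measurable => // i _.
rewrite -[X in measurable X]setTI; apply: mf => //.
exact: measurable_realfun.measurable_ball.
Qed.

End borel_rV.

Section lebesgue_rV_succ.
Context (R : realType) (n : nat).

Definition cons_rV (z : R * 'rV[R]_n) : 'rV[R]_n.+1 :=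
  row_mx (const_mx z.1 : 'M[R]_1) z.2.

Definition uncons_rV (x : 'rV[R]_n.+1) : R * 'rV[R]_n :=
  (x 0 0, \row_j x 0 (lift ord0 j)).

Lemma cons_rV0 z : cons_rV z 0 0 = z.1.
Proof. by rewrite mxE; case: splitP => // k _; rewrite mxE. Qed.

Lemma cons_rVS z j : cons_rV z 0 (lift ord0 j) = z.2 0 j.
Proof.
rewrite mxE; case: splitP => [[[|//] ?] //|k]; rewrite lift0 add1n => -[jk].
by congr (z.2 _ _); exact/val_inj.
Qed.

Lemma cons_rVK : cancel cons_rV uncons_rV.
Proof.
move=> z; rewrite /uncons_rV cons_rV0 [RHS]surjective_pairing; congr pair.
by apply/rowP => j; rewrite mxE cons_rVS.
Qed.

Lemma measurable_cons_rV :
  measurable_fun [set: (R * 'rV[R]_n)%type] cons_rV.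
Proof.
apply: measurable_rVP => i; case: (unliftP ord0 i) => [j|] ->.
  rewrite (_ : (fun _ => _) = (fun x : 'rV[R]_n => x 0 j) \o snd).
    by apply: measurableT_comp => //; exact: measurable_coord.
  by apply/funext => z; rewrite /= cons_rVS.
rewrite (_ : (fun _ => _) = fst) //.
by apply/funext => z; rewrite /= cons_rV0.
Qed.

Lemma measurable_uncons_rV : measurable_fun setT uncons_rV.
Proof.
apply/measurable_fun_pairP; split; first exact: measurable_coord.
apply: measurable_rVP => j; apply: eq_measurable_fun (measurable_coord (lift ord0 j)).
by move=> x _; rewrite /= mxE.
Qed.

Variable m : {sigma_finite_measure set 'rV[R]_n -> \bar R}.

Definition lebesgue_rV_succ : set 'rV[R]_n.+1 -> \bar R :=
  pushforward (lebesgue_measure \x m)%E cons_rV.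

Let succ0 : lebesgue_rV_succ set0 = 0%E.
Proof. by rewrite /lebesgue_rV_succ /pushforward preimage_set0 measure0. Qed.

Let succ_ge0 A : (0 <= lebesgue_rV_succ A)%E.
Proof. exact: (measure_ge0 (lebesgue_measure \x m)%E). Qed.

Let succ_sigma_additive : semi_sigma_additive lebesgue_rV_succ.
Proof.
move=> F mF tF mUF.
have mpre A : measurable A -> measurable (cons_rV @^-1` A).
  by move=> mA; rewrite -[X in measurable X]setTI; exact: measurable_cons_rV.
rewrite /lebesgue_rV_succ /pushforward preimage_bigcup.
apply: (@measure_semi_sigma_additive _ _ _ (lebesgue_measure \x m)%E) => [i||].
- exact: mpre.
- apply/trivIsetP => i j _ _ ij; rewrite -preimage_setI.
  by move/trivIsetP : tF => ->//; rewrite preimage_set0.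
- by rewrite -preimage_bigcup; exact: mpre.
Qed.

HB.instance Definition _ := isMeasure.Build _ _ _ lebesgue_rV_succ
  succ0 succ_ge0 succ_sigma_additive.

Let succ_sigma_finite : sigma_finite setT lebesgue_rV_succ.
Proof.
have /sigma_finiteP[F [FT ndF Foo]] := sigma_finiteT (@lebesgue_measure R).
have /sigma_finiteP[G [GT ndG Goo]] := sigma_finiteT m.
exists (fun k => uncons_rV @^-1` (F k `*` G k)).
  rewrite -preimage_bigcup (_ : \bigcup_k _ = setT) ?preimage_setT//.
  apply/seteqP; split=> // -[x y] _.
  have [i _ Fx] : (\bigcup_k F k) x by rewrite -FT.
  have [j _ Gy] : (\bigcup_k G k) y by rewrite -GT.
  exists (maxn i j) => //; split.
  - by move: x Fx; exact/subsetPset/ndF/leq_maxl.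
  - by move: y Gy; exact/subsetPset/ndG/leq_maxr.
move=> k; have [mF Fk] := Foo k; have [mG Gk] := Goo k; split.
  rewrite -[X in measurable X]setTI; apply: measurable_uncons_rV => //.
  exact: measurableX.
rewrite /lebesgue_rV_succ /pushforward -comp_preimage.
rewrite (_ : uncons_rV \o cons_rV = id); last exact/funext/cons_rVK.
rewrite preimage_id product_measure1E//.
by rewrite lte_mul_pinfty// ge0_fin_numE.
Qed.

HB.instance Definition _ := Measure_isSigmaFinite.Build _ _ _ lebesgue_rV_succ
  succ_sigma_finite.

End lebesgue_rV_succ.

Fixpoint lebesgue_rV (R : realType) (n : nat) :
    {sigma_finite_measure set 'rV[R]_n -> \bar R} :=
  match n return {sigma_finite_measure set 'rV[R]_n -> \bar R} with
  | 0 => \d_(0 : 'rV[R]_0)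
  | n'.+1 => lebesgue_rV_succ (lebesgue_rV R n')
  end.

Section sobolev.
Context (R : realType) (d : nat).
Implicit Types (Omega D : set 'rV[R]_d) (f g v eta : 'rV[R]_d -> R).

Local Notation leb := (lebesgue_rV R d).

(* Measurability with respect to the completion of the Borel sigma-algebra:
   f coincides almost everywhere on D with a Borel function. *)
Definition lebesgue_measurable_fun D f :=
  exists2 g, measurable_fun [set: 'rV[R]_d] g & ae_eq leb D f g.

(* Elements of L^2(Omega) are represented by functions on 'rV[R]_d whose values
   outside Omega are irrelevant. *)
Definition L2 Omega f :=
  exists2 g, g \in Lfun leb 2%:E & ae_eq leb Omega f g.

Definition partial (i : 'I_d) f : 'rV[R]_d -> R :=
  fun x => derive (f : 'rV[R]_d -> R^o) x (delta_mx 0 i).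

Definition smooth f := forall s : seq 'I_d, let g := foldr partial f s in
  continuous g /\
  forall i x, derivable (g : 'rV[R]_d -> R^o) x (delta_mx 0 i).

Definition test_function Omega eta :=
  smooth eta /\ exists C : set 'rV[R]_d,
    [/\ compact C, C `<=` Omega & forall x, ~ C x -> eta x = 0].

Definition is_weak_partial Omega (i : 'I_d) f g :=
  forall eta, test_function Omega eta ->
    \int[leb]_(x in Omega) (f x * partial i eta x) =
    - \int[leb]_(x in Omega) (g x * eta x).

(* A chosen representative of the weak derivative, unique up to null sets when
   it exists, and a default value otherwise. *)
Definition weak_partial Omega (i : 'I_d) f : 'rV[R]_d -> R :=
  xget (cst 0) [set g | L2 Omega g /\ is_weak_partial Omega i f g].

Definition H1 Omega f :=
  L2 Omega f /\ forall i, exists g, L2 Omega g /\ is_weak_partial Omega i f g.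

Definition H2 Omega f :=
  H1 Omega f /\ forall i, H1 Omega (weak_partial Omega i f).

(* closure of the test functions in the norm of H^1(Omega) *)
Definition H10 Omega f :=
  H1 Omega f /\ forall e : R, 0 < e -> exists2 eta, test_function Omega eta &
    \int[leb]_(x in Omega) (f x - eta x) ^+ 2 +
    \sum_(i < d) \int[leb]_(x in Omega)
      (weak_partial Omega i f x - partial i eta x) ^+ 2 < e.

Definition laplacian Omega f : 'rV[R]_d -> R :=
  fun x => \sum_(i < d) weak_partial Omega i (weak_partial Omega i f) x.

(* For d <= 3, H^2(Omega) embeds into the continuous functions on the closure
   of Omega. Elements of the intersection of H^2(Omega) and H^1_0(Omega) are
   represented by their continuous representative, the one meant by pointwise
   conditions and by integrals with respect to measures on K. *)
Definition H2H10 Omega f :=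
  [/\ {within closure Omega, continuous f}, H2 Omega f & H10 Omega f].

End sobolev.

(* Integral over D with respect to a signed measure, through its Jordan
   decomposition (which does not depend on the Hahn decomposition chosen). *)
Definition charge_integral d (T : measurableType d) (R : realType)
    (nu : {charge set T -> \bar R}) (D : set T) (f : T -> R) : R :=
  let: exist P hP := cid (Hahn_decomposition nu) in
  let: exist N nuPN := cid hP in
  \int[jordan_pos nuPN]_(x in D) f x - \int[jordan_neg nuPN]_(x in D) f x.

(* Bounded nonempty intersections of finitely many open half-spaces: the
   bounded convex polygonal (d = 2) or polyhedral (d = 3) domains. *)
Definition convex_polyhedral_domain (R : realType) (d : nat)
    (Omega : set 'rV[R]_d) :=
  [/\ Omega !=set0, bounded_set Omega &
      exists (m : nat) (a : 'I_m -> 'rV[R]_d) (b : 'I_m -> R),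
        Omega = [set x | forall k, \sum_(j < d) a k 0 j * x 0 j < b k]].

Record problem (R : realType) (d : nat) := Problem {
  Omega : set 'rV[R]_d ;
  phi : 'rV[R]_d -> R -> R ;
  ua : \bar R ;
  ub : \bar R ;
  y0 : 'rV[R]_d -> R ;
  alpha : R ;
  K : set 'rV[R]_d ;
  ya : 'rV[R]_d -> R ;
  yb : 'rV[R]_d -> R }.

Section control_problem.
Context (R : realType) (d : nat) (pb : problem R d).

Local Notation leb := (lebesgue_rV R d).
Local Notation Omega := (Omega pb).
Local Notation phi := (phi pb).
Local Notation ua := (ua pb).
Local Notation ub := (ub pb).
Local Notation y0 := (y0 pb).
Local Notation alpha := (alpha pb).
Local Notation K := (K pb).
Local Notation ya := (ya pb).
Local Notation yb := (yb pb).

Implicit Types (u v y z p : 'rV[R]_d -> R) (mu : {charge set 'rV[R]_d -> \bar R}).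

Definition phi_y (x : 'rV[R]_d) (t : R) : R := derive1 (phi x : R -> R^o) t.

Record standing_assumptions : Prop := {
  domain_Omega : convex_polyhedral_domain Omega ;
  phi_measurable : forall t, lebesgue_measurable_fun Omega (phi ^~ t) ;
  phi_C1 : {ae leb, forall x, Omega x ->
    (forall t, derivable (phi x : R -> R^o) t 1) /\ continuous (phi_y x)} ;
  phi_0 : {ae leb, forall x, Omega x -> phi x 0 = 0} ;
  phi_y_ge0 : {ae leb, forall x, Omega x -> forall t, 0 <= phi_y x t} ;
  phi_y_bounded : forall L : R, 0 <= L -> exists2 c : R, 0 <= c &
    {ae leb, forall x, Omega x -> forall t, `|t| <= L -> phi_y x t <= c} ;
  ua_le_ub : (ua <= ub)%E ;
  y0_L2 : L2 Omega y0 ;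
  alpha_gt0 : 0 < alpha ;
  K_compact : compact K ;
  K_position : K `<=` Omega \/ K = closure Omega ;
  ya_continuous : {within closure Omega, continuous ya} ;
  yb_continuous : {within closure Omega, continuous yb} ;
  ya_lt_yb : forall x, K x -> ya x < yb x ;
  boundary_sign : K = closure Omega ->
    forall x, closure Omega x -> ~ Omega x -> ya x < 0 < yb x }.

Definition Uad u := L2 Omega u /\
  {ae leb, forall x, Omega x -> (ua <= (u x)%:E <= ub)%E}.

(* The graph y = G(u) of the control-to-state map: the boundary value problem
   has exactly one solution y for every u in L^2(Omega). *)
Definition state u y := H2H10 Omega y /\
  {ae leb, forall x, Omega x -> - laplacian Omega y x + phi x (y x) = u x}.

Definition state_constraints y := forall x, K x -> ya x <= y x <= yb x.

(* The value J(u), where y is meant to be the state G(u). *)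
Definition J u y : R :=
  2^-1 * \int[leb]_(x in Omega) (y x - y0 x) ^+ 2 +
  alpha / 2 * \int[leb]_(x in Omega) (u x) ^+ 2.

Definition feasible u y := [/\ Uad u, state u y & state_constraints y].

Definition global_minimum u := exists2 y, feasible u y &
  forall v z, feasible v z -> J u y <= J v z.

Definition unique_global_minimum u :=
  global_minimum u /\
  forall v, global_minimum v -> ae_eq leb Omega v u.

(* The measure mu on K is given by a finite signed Borel measure on the whole
   space, of which only the restriction to K matters; such measures are
   automatically regular. *)
Record first_order_system u y p mu : Prop := {
  fos_u : Uad u ;
  fos_y : H2H10 Omega y ;
  fos_p : L2 Omega p ;
  fos_state : forall v, H10 Omega v ->
    \int[leb]_(x in Omega)
      (\sum_(i < d) weak_partial Omega i y x * weak_partial Omega i v x +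
       phi x (y x) * v x) =
    \int[leb]_(x in Omega) (u x * v x) ;
  fos_constraints : state_constraints y ;
  fos_adjoint : forall v, H2H10 Omega v ->
    \int[leb]_(x in Omega)
      (p x * (- laplacian Omega v x) + phi_y x (y x) * p x * v x) =
    \int[leb]_(x in Omega) ((y x - y0 x) * v x) + charge_integral mu K v ;
  fos_control : forall u', Uad u' ->
    0 <= \int[leb]_(x in Omega) ((p x + alpha * u x) * (u' x - u x)) ;
  fos_multiplier : forall z, {within K, continuous z} ->
    (forall x, K x -> ya x <= z x <= yb x) ->
    charge_integral mu K (fun x => z x - y x) <= 0 }.

Definition phi_convex_on (I : interval R) :=
  {ae leb, forall x, Omega x ->
    @convex_function R R^o [set` I] (phi x)}.

Definition phi_concave_on (I : interval R) :=
  {ae leb, forall x, Omega x ->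
    @convex_function R R^o [set` I] (fun t => - phi x t)}.

End control_problem.

(* Main.v *)
Require Import Defs.
From mathcomp Require Import all_boot all_order all_algebra.
From mathcomp Require Import all_classical all_reals all_analysis.
From mathcomp Require Import measurable_realfun ring lra.
Import Order.TTheory GRing.Theory Num.Theory.
Import numFieldNormedType.Exports.
Local Open Scope classical_set_scope.
Local Open Scope ring_scope.

(** Write w = z - y and s = v - u for a feasible control v with state z.
    Since the cost is quadratic, J(v) - J(u) is exactly the sum of the linear
    part, the integral of (y - y0) w + alpha u s, and of one half of the
    squared norm of w plus alpha / 2 times that of s.  The function w is
    admissible in the adjoint equation, and the two state equations give
    - Laplacian w = s - (phi(z) - phi(y)), so the linear part equals

      int (p + alpha u) s
        - int p (phi(z) - phi(y) - phi_y(y) w) - int_K w dmu.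

    The first term is nonnegative by the variational inequality for the
    control, and the last one by the multiplier inequality.  In the middle term
    the bracket compares phi(x, .) with its tangent at y(x): it is nonnegative
    when phi(x, .) is convex on I and nonpositive when it is concave, so that
    the sign condition on p makes the whole term nonnegative.  Hence
    J(v) - J(u) is at least alpha / 2 times the squared distance of v to u
    (quadratic_growth), which gives minimality and uniqueness at once.

    Two facts about weak derivatives make this rigorous.  The pair (u, y) must
    be feasible, that is, the weak state equation must hold pointwise almost
    everywhere (first_order_state); and the difference of two states must again
    lie in the state space, with the difference of the Laplacians as its
    Laplacian (H2H10B, laplacianB).  Both follow from the fundamental lemma of
    the calculus of variations (fundamental_lemma): an integrable function that
    is orthogonal to all test functions vanishes almost everywhere.  In
    particular weak derivatives are unique up to null sets, hence additive.

    The fundamental lemma needs enough test functions.  They are built from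
    functions t |-> P(1/t) exp(-1/t), extended by 0 to t <= 0, where P is a
    polynomial.  This family is closed under differentiation, and
    exp(-1/(k t)) tends to the indicator of t > 0 as k grows.  Products over
    the coordinates approximate the indicator functions of boxes, and boxes
    generate the Borel sets.  To use test functions in the weak state equation
    one also has to know that their weak derivatives are the classical ones.
    This is integration by parts, and reduces to the vanishing of the integral
    of a partial derivative of a compactly supported function
    (integral_partial): Fubini along the construction of the measure as an
    iterated product, and the fundamental theorem of calculus.

    Elements of the function spaces only coincide almost everywhere with Borel
    functions.  Integration of such functions rests on the observation that the
    integral is unchanged by modifications on null sets even when they destroy
    measurability (integral_ae_eq_nonmeasurable). *)

Set Implicit Arguments.
Unset Strict Implicit.
Unset Printing Implicit Defensive.

(** * Integration modulo null sets *)

Lemma ae_and dT (T : measurableType dT) (R : realType) (mu : {measure set T -> \bar R})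
    (P Q : T -> Prop) :
  {ae mu, forall x, P x} -> {ae mu, forall x, Q x} -> {ae mu, forall x, P x /\ Q x}.
Proof. by apply: filterS2 => x Px Qx. Qed.

Section integration_modulo_null_sets.
Context d (T : measurableType d) (R : realType) (mu : {measure set T -> \bar R}).
Implicit Types (D : set T) (f g h : T -> R).

Import HBNNSimple.

(** The integral of a nonnegative function is a supremum over the simple
    functions below it.  Cutting such a simple function to 0 on the exceptional
    null set puts it below the other function without changing its integral, and
    this compares the integrals even of functions that are not measurable. *)
Lemma ge0_integral_ae_le D (f g : T -> \bar R) :
  (forall x, D x -> 0 <= f x)%E -> (forall x, D x -> 0 <= g x)%E ->
  ae_eq mu D f g -> (\int[mu]_(x in D) f x <= \int[mu]_(x in D) g x)%E.
Proof.
move=> f0 g0 [N [mN N0 fgN]]; rewrite !ge0_integralE//.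
apply: ge_ereal_sup => _ [h hf <-].
have mNC := measurableC mN.
have pE x : proj_nnsfun h mNC x = if x \in ~` N then h x else 0.
  by rewrite -[LHS]/((proj_nnsfun h mNC : T -> R) x) -mrestrict.
apply: le_ereal_sup_tmp; exists (sintegral mu (proj_nnsfun h mNC)).
  exists (proj_nnsfun h mNC) => // x; rewrite pE.
  have [xN|xN] := boolP (x \in ~` N); last first.
    by rewrite patchE; case: ifPn => // /set_mem /g0.
  have := hf x; rewrite !patchE; case: ifPn => // xD.
  suff -> : f x = g x by [].
  apply: contrapT => fgx; have := set_mem xN; apply; apply: fgN => /= /(_ (set_mem xD)).
  by [].
rewrite -!integralT_nnsfun.
rewrite le_eqVlt; apply/orP; left; apply/eqP.
apply: ae_eq_integral => //.
- by apply/measurable_EFinP.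
- by apply/measurable_EFinP; exact: (@measurable_funPT _ _ _ _ (proj_nnsfun h mNC)).
- exists N; split => // x nx; apply: contrapT => xN; apply: nx => _.
  by congr EFin; have := pE x; rewrite mem_set.
Qed.

Lemma integral_ae_eq_nonmeasurable D (f g : T -> \bar R) :
  ae_eq mu D f g -> (\int[mu]_(x in D) f x = \int[mu]_(x in D) g x)%E.
Proof.
move=> fg; have [fgp fgn] := (ae_eq_funeposneg mu D f g).1 fg.
have eqI (h k : T -> \bar R) : (forall x, 0 <= h x)%E -> (forall x, 0 <= k x)%E ->
    ae_eq mu D h k -> (\int[mu]_(x in D) h x = \int[mu]_(x in D) k x)%E.
  move=> h0 k0 hk; apply/eqP; rewrite eq_le !ge0_integral_ae_le//.
  exact: ae_eq_sym.
by rewrite integralE [RHS]integralE (eqI _ _ _ _ fgp)// (eqI _ _ _ _ fgn).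
Qed.

Lemma ae_eq_Rintegral D f g : ae_eq mu D f g ->
  \int[mu]_(x in D) f x = \int[mu]_(x in D) g x.
Proof.
by move=> fg; congr fine; apply: integral_ae_eq_nonmeasurable; exact: ae_eq_comp fg.
Qed.

Lemma ae_ge0_Rintegral D f : {ae mu, forall x, D x -> 0 <= f x} ->
  0 <= \int[mu]_(x in D) f x.
Proof.
move=> f0; rewrite (@ae_eq_Rintegral _ f (fun x => `|f x|)); last first.
  by apply: filterS f0 => x f0 /f0 /ger0_norm.
exact: Rintegral_ge0.
Qed.

(** Integrability for the completed measure, expressed through a representative
    that is measurable for the original sigma-algebra. *)
Definition ae_integrable D f :=
  exists2 g, mu.-integrable D (EFin \o g) & ae_eq mu D f g.

Lemma ae_integrableD D f g : measurable D ->
  ae_integrable D f -> ae_integrable D g -> ae_integrable D (fun x => f x + g x).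
Proof.
move=> mD [f' f'i ff'] [g' g'i gg']; exists (fun x => f' x + g' x).
  by rewrite (_ : _ \o _ = (EFin \o f') \+ (EFin \o g'))%E//; exact: integrableD.
by apply: filterS2 ff' gg' => x + + Dx => -> // ->.
Qed.

Lemma ae_integrableZ D f r : measurable D ->
  ae_integrable D f -> ae_integrable D (fun x => r * f x).
Proof.
move=> mD [f' f'i ff']; exists (fun x => r * f' x).
  by rewrite (_ : _ \o _ = (fun x => r%:E * (EFin \o f') x)%E)//; exact: integrableZl.
by apply: filterS ff' => x + Dx => ->.
Qed.

Lemma ae_integrableN D f : measurable D ->
  ae_integrable D f -> ae_integrable D (fun x => - f x).
Proof.
move=> mD /(ae_integrableZ (-1) mD); rewrite (_ : (fun x => -1 * f x) = fun x => - f x)//.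
by apply/funext => x; rewrite mulN1r.
Qed.

Lemma ae_integrable0 D : measurable D -> ae_integrable D (fun=> 0).
Proof. by move=> mD; exists (cst 0); [exact: (integrable0 mu D)|exact: ae_eq_refl]. Qed.

Lemma ae_integrable_sum (I : Type) (s : seq I) D (F : I -> T -> R) :
  measurable D -> (forall i, ae_integrable D (F i)) ->
  ae_integrable D (fun x => \sum_(i <- s) F i x).
Proof.
move=> mD Fi; elim: s => [|i s IH].
  rewrite (_ : (fun _ => _) = fun=> 0); first exact: ae_integrable0.
  by apply/funext => x; rewrite big_nil.
rewrite (_ : (fun _ => _) = fun x => F i x + \sum_(j <- s) F j x).
  exact: ae_integrableD.
by apply/funext => x; rewrite big_cons.
Qed.

Lemma ae_RintegralD D f g : measurable D ->
  ae_integrable D f -> ae_integrable D g ->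
  \int[mu]_(x in D) (f x + g x) = \int[mu]_(x in D) f x + \int[mu]_(x in D) g x.
Proof.
move=> mD [f' f'i ff'] [g' g'i gg'].
rewrite (ae_eq_Rintegral ff') (ae_eq_Rintegral gg') -RintegralD//.
by apply: ae_eq_Rintegral; apply: filterS2 ff' gg' => x + + Dx => -> // ->.
Qed.

Lemma ae_RintegralZ D f r : measurable D -> ae_integrable D f ->
  \int[mu]_(x in D) (r * f x) = r * \int[mu]_(x in D) f x.
Proof.
move=> mD [f' f'i ff']; rewrite (ae_eq_Rintegral ff') -RintegralZl//.
by apply: ae_eq_Rintegral; apply: filterS ff' => x + Dx => ->.
Qed.

Lemma ae_RintegralN D f : measurable D -> ae_integrable D f ->
  \int[mu]_(x in D) (- f x) = - \int[mu]_(x in D) f x.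
Proof.
move=> mD fi; rewrite -mulN1r -ae_RintegralZ//.
by congr Rintegral; apply/funext => x; rewrite mulN1r.
Qed.

Lemma ae_RintegralB D f g : measurable D ->
  ae_integrable D f -> ae_integrable D g ->
  \int[mu]_(x in D) (f x - g x) = \int[mu]_(x in D) f x - \int[mu]_(x in D) g x.
Proof.
by move=> mD fi gi; rewrite ae_RintegralD ?ae_RintegralN//; exact: ae_integrableN.
Qed.

Lemma Rintegral0 D : \int[mu]_(x in D) 0 = 0 :> R.
Proof. by rewrite /Rintegral integral0. Qed.

Lemma ae_Rintegral_sum (I : Type) (s : seq I) D (F : I -> T -> R) :
  measurable D -> (forall i, ae_integrable D (F i)) ->
  \int[mu]_(x in D) (\sum_(i <- s) F i x) = \sum_(i <- s) \int[mu]_(x in D) F i x.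
Proof.
move=> mD Fi; elim: s => [|i s IH].
  rewrite big_nil -[RHS](Rintegral0 D); congr Rintegral.
  by apply/funext => x; rewrite big_nil.
rewrite big_cons -IH -ae_RintegralD//; last exact: ae_integrable_sum.
by congr Rintegral; apply/funext => x; rewrite big_cons.
Qed.

Lemma ae_le_Rintegral D f g : measurable D ->
  ae_integrable D f -> ae_integrable D g ->
  {ae mu, forall x, D x -> f x <= g x} ->
  \int[mu]_(x in D) f x <= \int[mu]_(x in D) g x.
Proof.
move=> mD fi gi fg; rewrite -subr_ge0 -ae_RintegralB//.
by apply: ae_ge0_Rintegral; apply: filterS fg => x + Dx; rewrite subr_ge0; exact.
Qed.

Lemma ae_Rintegral_eq0 D f : measurable D -> ae_integrable D f ->
  {ae mu, forall x, D x -> 0 <= f x} -> \int[mu]_(x in D) f x <= 0 ->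
  ae_eq mu D f (fun=> 0).
Proof.
move=> mD fi f0 If.
have {}If : \int[mu]_(x in D) f x = 0.
  by apply/eqP; rewrite eq_le If ae_ge0_Rintegral.
have [g gi fg] := fi.
have mg := measurable_int _ gi.
have : ae_eq mu D (EFin \o g) (cst 0%E).
  apply/(ae_eq_integral_abs mu mD mg).
  have gabs : \int[mu]_(x in D) `|g x| = 0.
    rewrite -If; apply: ae_eq_Rintegral.
    by apply: filterS2 fg f0 => x + + Dx => /(_ Dx) <- /(_ Dx) /ger0_norm.
  have : (\int[mu]_(x in D) `|(g x)%:E|)%E \is a fin_num.
    by apply: integrable_fin_num => //; exact: integrable_abse.
  by move=> /fineK <-; rewrite -[X in X%:E = _]/(\int[mu]_(x in D) `|g x|) gabs.
apply: filterS2 fg => x /[swap] + + Dx => /(_ Dx) [->] h.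
by rewrite h.
Qed.

End integration_modulo_null_sets.

(** * Measurability and square integrability modulo null sets *)

Lemma ae_forall_countable d (T : measurableType d) (R : realType)
    (mu : {measure set T -> \bar R}) (I : countType) (P : I -> T -> Prop) :
  (forall i, {ae mu, forall x, P i x}) -> {ae mu, forall x, forall i, P i x}.
Proof.
move=> aeP.
have : {ae mu, forall x, forall n, if unpickle n is Some i then P i x else True}.
  apply: ae_foralln => n; case: (unpickle n) => [i|]; first exact: aeP.
  exact: aeW.
by apply: filterS => x xP i; have := xP (pickle i); rewrite pickleK.
Qed.

Lemma sqr_integrable_Lfun2 d (T : measurableType d) (R : realType)
    (mu : {measure set T -> \bar R}) (f : T -> R) :
  measurable_fun setT f -> mu.-integrable setT (EFin \o (fun x => f x ^+ 2)) ->
  f \in Lfun mu 2%:E.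
Proof.
move=> mf /integrableP[_ fi]; rewrite inE; apply/andP; split; rewrite inE//=.
rewrite /finite_norm unlock /Lnorm poweR_lty//.
apply: le_lt_trans fi; rewrite le_eqVlt; apply/orP; left; apply/eqP.
apply: eq_integral => x _ /=; congr EFin.
by rewrite -[2]/(2%:R) powR_mulrn// normrX.
Qed.

Section measurability_modulo_null_sets.
Context (R : realType) (d : nat).
Implicit Types (D : set 'rV[R]_d) (f g h : 'rV[R]_d -> R).
Local Notation leb := (lebesgue_rV R d).

Lemma lebesgue_measurable_fun_comp D f (F : R -> R) : measurable_fun setT F ->
  lebesgue_measurable_fun D f -> lebesgue_measurable_fun D (F \o f).
Proof.
move=> mF [g mg fg]; exists (F \o g); first exact: measurableT_comp.
exact: ae_eq_comp.
Qed.

Lemma lebesgue_measurable_funD D f g : lebesgue_measurable_fun D f ->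
  lebesgue_measurable_fun D g -> lebesgue_measurable_fun D (fun x => f x + g x).
Proof.
move=> [f' mf ff] [g' mg gg]; exists (fun x => f' x + g' x).
  exact: measurable_funD.
by apply: filterS2 ff gg => x + + Dx => -> // ->.
Qed.

Lemma lebesgue_measurable_funM D f g : lebesgue_measurable_fun D f ->
  lebesgue_measurable_fun D g -> lebesgue_measurable_fun D (fun x => f x * g x).
Proof.
move=> [f' mf ff] [g' mg gg]; exists (fun x => f' x * g' x).
  exact: measurable_funM.
by apply: filterS2 ff gg => x + + Dx => -> // ->.
Qed.

(** Outside a null set the limit is the upper limit of Borel representatives,
    which is defined, and Borel, everywhere. *)
Lemma lebesgue_measurable_fun_lim D (F : nat -> 'rV[R]_d -> R) f :
  (forall k, lebesgue_measurable_fun D (F k)) ->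
  {ae leb, forall x, D x -> F ^~ x @ \oo --> f x} ->
  lebesgue_measurable_fun D f.
Proof.
move=> mF Ff.
have /choice[G GP] : forall k, exists g,
    measurable_fun [set: 'rV[R]_d] g /\ ae_eq leb D (F k) g.
  by move=> k; have [g mg Fg] := mF k; exists g.
exists (fun x => fine (limn_esup (fun k => (G k x)%:E))).
  apply: measurableT_comp => //; apply: measurable_fun_limn_esup => k.
  by apply/measurable_EFinP; exact: (GP k).1.
have GF : {ae leb, forall x, forall k, D x -> F k x = G k x}.
  by apply: ae_foralln => k; exact: (GP k).2.
apply: filterS2 Ff GF => x Ff GF Dx.
have Gf : (fun k => (G k x)%:E) @ \oo --> (f x)%:E.
  apply: cvg_EFin; first exact: nearW.
  rewrite (_ : _ \o _ = F ^~ x); first exact: Ff.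
  by apply/funext => k /=; rewrite GF.
by rewrite limn_esup_lim; have /cvg_lim -> // := cvg_esups Gf.
Qed.

Let grid (k : nat) (t : R) : R := (Num.floor (t * k.+1%:R))%:~R / k.+1%:R.

Let grid_cvg t : grid ^~ t @ \oo --> t.
Proof.
apply/cvgrPdist_le => /= e e0.
near=> k; have k0 : 0 < k.+1%:R :> R by rewrite ltr0Sn.
have /andP[fl fu] : (Num.floor (t * k.+1%:R))%:~R <= t * k.+1%:R <
    (Num.floor (t * k.+1%:R))%:~R + 1.
  by rewrite ge_floor// -[X in _ < _ + X]/(1%:~R) -intrD floorD1_gt.
have ke : k.+1%:R^-1 <= e.
  by apply: ltW; near: k; exact: (near_infty_natSinv_lt (PosNum e0)).
rewrite /grid ger0_norm.
  apply: le_trans ke; rewrite lerBlDr -[X in _ <= X + _]mul1r -mulrDl ler_pdivlMr//.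
  by rewrite addrC ltW.
by rewrite subr_ge0 ler_pdivrMr.
Unshelve. all: by end_near. Qed.

(** Round [f] down to the grid of mesh 1/(k+1): the superposition then takes
    countably many second arguments, each of which has a Borel representative, and
    these are glued along the level sets of the rounded function.  Continuity in the
    second variable lets k tend to infinity. *)
Lemma superposition_lebesgue_measurable D (phi : 'rV[R]_d -> R -> R) f :
  (forall t, lebesgue_measurable_fun D (phi ^~ t)) ->
  {ae leb, forall x, D x -> continuous (phi x)} ->
  lebesgue_measurable_fun D f ->
  lebesgue_measurable_fun D (fun x => phi x (f x)).
Proof.
move=> mphi cphi [g mg fg].
apply: (@lebesgue_measurable_fun_lim _ (fun k x => phi x (grid k (g x)))); last first.
  apply: filterS2 cphi fg => x cphi fg Dx; rewrite fg//.
  by apply: continuous_cvg; [exact: cphi|exact: grid_cvg].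
move=> k.
have /choice[G GP] : forall n : int, exists h,
    measurable_fun [set: 'rV[R]_d] h /\ ae_eq leb D (phi ^~ (n%:~R / k.+1%:R)) h.
  by move=> n; have [h mh ph] := mphi (n%:~R / k.+1%:R); exists h.
exists (fun x => G (Num.floor (g x * k.+1%:R)) x); last first.
  have /ae_forall_countable : forall n, {ae leb, forall x, D x ->
    phi x (n%:~R / k.+1%:R) = G n x} by move=> n; exact: (GP n).2.
  by apply: filterS => x /(_ (Num.floor (g x * k.+1%:R))).
move=> _ B mB; rewrite setTI.
rewrite (_ : _ @^-1` B = \bigcup_(n : int)
    ((fun x => g x * k.+1%:R) @^-1` `[n%:~R, (n + 1)%:~R[ `&` G n @^-1` B)).
  apply: countable_bigcupT_measurable => [|n]; first exact: countableP.
  apply: measurableI; last by rewrite -[X in measurable X]setTI; exact: (GP n).1.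
  rewrite -[X in measurable X]setTI.
  have mgk : measurable_fun setT (fun x => g x * k.+1%:R) by exact: measurable_funM.
  by apply: mgk => //; exact: measurable_itv.
apply/seteqP; split => [x /= Bx|x [n _ [/=]]].
  exists (Num.floor (g x * k.+1%:R)) => //; split => //=.
  by rewrite in_itv/= ge_floor// floorD1_gt.
by rewrite in_itv/= => /floor_def ->.
Qed.

End measurability_modulo_null_sets.

Section square_integrable_functions.
Context (R : realType) (d : nat).
Implicit Types (D : set 'rV[R]_d) (f g h : 'rV[R]_d -> R).
Local Notation leb := (lebesgue_rV R d).

Lemma L2_measurable D f : L2 D f -> lebesgue_measurable_fun D f.
Proof. by move=> [g]; rewrite inE => /andP[/set_mem /= mg _] fg; exists g. Qed.

Lemma ae_eq_L2 D f g : ae_eq leb D f g -> L2 D g -> L2 D f.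
Proof. by move=> fg [h mh gh]; exists h => //; exact: ae_eq_trans fg gh. Qed.

(** The Borel representative of [f] is only controlled on [D], whereas membership
    in L^2 asks for a representative that is square integrable on the whole space;
    cutting it to 0 where its square exceeds [G] achieves this. *)
Lemma L2_dominated D f (G : 'rV[R]_d -> R) : lebesgue_measurable_fun D f ->
  leb.-integrable setT (EFin \o G) ->
  {ae leb, forall x, D x -> f x ^+ 2 <= G x} -> L2 D f.
Proof.
move=> [g mg fg] Gi fG.
have mG : measurable_fun setT G by apply/measurable_EFinP; exact: measurable_int Gi.
pose A := [set x | g x ^+ 2 <= G x].
have mA : measurable A.
  rewrite -[A]setTI; apply: measurable_fun_le => //; exact: measurable_funX.
have mh : measurable_fun setT (fun x => g x * \1_A x).
  by apply: measurable_funM => //; exact: measurable_indic.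
exists (fun x => g x * \1_A x); last first.
  apply: filterS2 fg fG => x + + Dx => /(_ Dx) fg /(_ Dx) fG.
  by rewrite indicE mem_set ?mulr1 //= /A /= -fg.
apply: sqr_integrable_Lfun2 => //.
apply: le_integrable Gi => //.
  by apply/measurable_EFinP; exact: measurable_funX.
move=> x _ /=; rewrite lee_fin indicE; case: (boolP (x \in A)) => [/set_mem /= Ax|_].
  by rewrite mulr1 ger0_norm ?sqr_ge0// (le_trans Ax)// ler_norm.
by rewrite mulr0 expr0n normr0.
Qed.

Let le12 : (1 <= 2%:E :> \bar R)%E. Proof. by rewrite lee_fin ler1n. Qed.

Lemma L2D D f g : L2 D f -> L2 D g -> L2 D (fun x => f x + g x).
Proof.
move=> [f' Lf ff] [g' Lg gg]; exists (fun x => f' x + g' x).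
  exact: (@Lfun_addr_closed _ _ _ leb _ le12).2.
by apply: filterS2 ff gg => x + + Dx => -> // ->.
Qed.

Lemma L2Z D f r : L2 D f -> L2 D (fun x => r * f x).
Proof.
move=> [g Lg fg]; exists (fun x => r * g x).
  rewrite (_ : (fun _ => _) = r \o* g); last by apply/funext => x; rewrite /= mulrC.
  by apply: Lfun_scale => //; rewrite ler1n.
by apply: filterS fg => x + Dx => ->.
Qed.

Lemma L2N D f : L2 D f -> L2 D (fun x => - f x).
Proof.
move=> /(L2Z (-1)); rewrite (_ : (fun x => -1 * f x) = fun x => - f x)//.
by apply/funext => x; rewrite mulN1r.
Qed.

Lemma L2B D f g : L2 D f -> L2 D g -> L2 D (fun x => f x - g x).
Proof. by move=> Lf Lg; apply: L2D => //; exact: L2N. Qed.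

Lemma L20 D : L2 D (fun=> 0).
Proof.
exists (fun=> 0); last exact: ae_eq_refl.
exact: (@Lfun_addr_closed _ _ _ leb _ le12).1.
Qed.

Lemma L2_sum (I : Type) (s : seq I) D (F : I -> 'rV[R]_d -> R) :
  (forall i, L2 D (F i)) -> L2 D (fun x => \sum_(i <- s) F i x).
Proof.
move=> LF; elim: s => [|i s IH].
  by rewrite (_ : (fun _ => _) = fun=> 0); [exact: L20|apply/funext => x; rewrite big_nil].
rewrite (_ : (fun _ => _) = fun x => F i x + \sum_(j <- s) F j x); first exact: L2D.
by apply/funext => x; rewrite big_cons.
Qed.

Lemma L2M_integrable D f g : measurable D -> L2 D f -> L2 D g ->
  ae_integrable leb D (fun x => f x * g x).
Proof.
move=> mD [f' Lf ff] [g' Lg gg]; exists (fun x => f' x * g' x).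
  apply: (@integrableS _ _ _ leb setT) => //.
  by apply/Lfun1_integrable; exact: Lfun2_mul_Lfun1.
by apply: filterS2 ff gg => x + + Dx => -> // ->.
Qed.

Lemma L2_sqr_integrable D f : measurable D -> L2 D f ->
  ae_integrable leb D (fun x => f x ^+ 2).
Proof.
by move=> mD Lf; rewrite (_ : (fun _ => _) = fun x => f x * f x)//; exact: L2M_integrable.
Qed.

Lemma L2_le D f g : lebesgue_measurable_fun D f -> L2 D g ->
  {ae leb, forall x, D x -> `|f x| <= `|g x|} -> L2 D f.
Proof.
move=> mf [g' Lg gg] fg.
apply: (L2_dominated mf (Lfun2_integrable_sqr Lg)).
apply: filterS2 gg fg => x + + Dx => /(_ Dx) <- /(_ Dx).
by move=> fg; rewrite -[f x ^+ 2]real_normK ?num_real// -[leRHS]real_normK ?num_real// ler_pXn2r// nnegrE.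
Qed.

End square_integrable_functions.

(** * Functions flat at the origin *)

Section flat_functions.
Context (R : realType).
Implicit Types (P : {poly R}) (t : R).

(** The family of these functions is closed under differentiation because the
    derivative of P(1/t) exp(-1/t) is again of this form, for the polynomial
    (P - P') X^2. *)
Definition flat P t : R := if 0 < t then P.[t^-1] * expR (- t^-1) else 0.

Lemma flat_le0 P t : t <= 0 -> flat P t = 0.
Proof. by rewrite /flat ltNge => ->. Qed.

(** The exponential beats every power: with s = 1/t >= 1 one has
    |P(s)| <= M s^n, where n is the size of P and M the sum of the absolute values
    of its coefficients, while exp(s) >= s^(n+1) / (n+1)!.  Applied to P X, the
    bound yields both the continuity and the vanishing derivative of [flat P] at
    0. *)
Lemma flat_linear_bound P : exists C : R, 0 <= C /\
  forall t, t <= 1 -> `|flat P t| <= C * `|t|.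
Proof.
pose M := \sum_(i < size P) `|P`_i|; pose n := size P.
have M0 : 0 <= M by exact: sumr_ge0.
exists (M * n.+1`!%:R); split; first by rewrite mulr_ge0.
move=> t t1; case: (ltP 0 t) => t0; last first.
  by rewrite flat_le0// normr0 mulr_ge0// mulr_ge0.
rewrite /flat t0 normrM (gtr0_norm t0) (ger0_norm (expR_ge0 _)) expRN.
have s1 : 1 <= t^-1 by rewrite invf_ge1.
have s0 : 0 < t^-1 by rewrite invr_gt0.
have PM : `|P.[t^-1]| <= M * t^-1 ^+ n.
  rewrite horner_coef (le_trans (ler_norm_sum _ _ _))// /M mulr_suml.
  apply: ler_sum => i _; rewrite normrM ler_wpM2l// normrX gtr0_norm//.
  by rewrite ler_weXn2l// ltnW// ltn_ord.
have eb : (expR t^-1)^-1 <= n.+1`!%:R / t^-1 ^+ n.+1.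
  rewrite -[X in _ <= X]invrK lef_pV2 ?posrE ?expR_gt0 ?invr_gt0 ?divr_gt0 ?exprn_gt0 ?ltr0n ?fact_gt0//.
  rewrite invf_div; apply: le_trans (expR_ge1Dxn n (ltW s0)).
  by rewrite lerDr.
apply: (le_trans (ler_pM _ _ PM eb)); rewrite ?invr_ge0 ?expR_ge0//.
rewrite exprS invfM invrK mulrACA -!mulrA.
rewrite le_eqVlt; apply/orP; left; apply/eqP.
have tn : t^-1 ^+ n != 0 by rewrite expf_neq0// gt_eqF.
by field; exact: tn.
Qed.

Lemma is_derive_flat P t :
  is_derive t (1 : R) (flat P : R -> R) (flat ((P - P^`()) * 'X^2) t).
Proof.
have [t0|t0|t0] := ltgtP t 0.
- rewrite flat_le0 ?ltW//.
  (* For t < 0 the function vanishes near t. *)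
  apply: (@near_eq_is_derive _ _ _ (cst 0)) => //.
  + by near=> s; rewrite /= flat_le0// ltW//; near: s; exact: lt_nbhsl.
- rewrite {2}/flat t0.
  apply: (@near_eq_is_derive _ _ _ (fun s : R => P.[s^-1] * expR (- s^-1) : R^o)).
  + by near=> s; rewrite /flat ifT//; near: s; exact: lt_nbhsr.
  have tn0 : t != 0 by rewrite gt_eqF.
  have dV := @is_deriveV _ id t 1 1 tn0 (is_derive_id _ _).
  have dP := @is_derive1_comp _ (horner P) _ _ _ _ (is_derive_poly _ _) dV.
  have dE := @is_derive1_comp _ expR _ _ _ _ (is_derive_expR _) (is_deriveN dV).
  have dPE := is_deriveM dP dE.
  refine (@is_derive_eq _ _ _ _ _ _ _ _ dPE _).
  rewrite !hornerE /GRing.scale /= !mulr1.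
  by field.
- rewrite t0 flat_le0//.
  (* At 0 the difference quotient of flat P is flat (P * 'X), which is O(h). *)
  have [C [C0 CP]] := flat_linear_bound (P * 'X).
  have dq : (fun h => h^-1 *: ((flat P \o shift 0) (h *: 1) - flat P 0)) @ 0^' --> (0 : R).
    rewrite (_ : (fun _ => _) = flat (P * 'X)); last first.
      apply/funext => h /=; rewrite addr0 /GRing.scale /= mulr1 (@flat_le0 _ 0)// subr0.
      rewrite /flat; case: ifPn => h0; last by rewrite mulr0.
      by rewrite hornerMX mulrC -!mulrA; congr *%R; rewrite mulrC.
    apply/cvgrPdist_le => /= e e0.
    have C1 : 0 < C + 1 by rewrite ltr_wpDl.
    have m0 : 0 < Num.min 1 (e / (C + 1)) by rewrite lt_min ltr01 divr_gt0.
    have := @pseudometric_normed_Zmodule.nbhs0_lt _ R^o _ m0.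
    rewrite near_withinE; apply: filterS => h /ltW he _; rewrite sub0r normrN.
    move: he; rewrite le_min => /andP[h1 he].
    apply: (le_trans (CP h (le_trans (ler_norm _) h1))).
    apply: (@le_trans _ _ ((C + 1) * `|h|)); first by rewrite ler_wpM2r// lerDl.
    by rewrite mulrC -ler_pdivlMr.
  split; last by apply/cvg_lim.
  by apply/cvg_ex; exists 0.
Unshelve. all: by end_near. Qed.

Lemma continuous_flat P : continuous (flat P).
Proof.
move=> t; apply/differentiable_continuous/derivable1_diffP.
by case: (is_derive_flat P t).
Qed.

End flat_functions.

(** * Smooth bump functions on boxes *)

Section flat_scaling.
Context (R : realType).
Implicit Types t : R.

Lemma flat1_itv t : 0 <= flat 1 t <= 1.
Proof.
rewrite /flat; case: ifPn => t0; last by rewrite lexx ler01.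
by rewrite hornerC mul1r expR_ge0 expR_le1 oppr_le0 invr_ge0 ltW.
Qed.

Lemma flat1_scaled_cvg t : 0 < t -> flat 1 (k.+1%:R * t) @[k --> \oo] --> (1 : R).
Proof.
move=> t0; rewrite (_ : (fun _ => _) = fun k => expR (- (k.+1%:R^-1 * t^-1))); last first.
  by apply/funext => k; rewrite /flat ifT ?mulr_gt0// hornerC mul1r invfM.
rewrite -[X in _ --> X]expR0; apply: continuous_cvg; first exact: continuous_expR.
rewrite -oppr0; apply: cvgN; rewrite -[X in _ --> X](mul0r t^-1).
by apply: cvgMr_tmp; apply: (@cvg_harmonic R).
Qed.

End flat_scaling.

Section directional_derivatives_along_lines.
Context (R : realType) (V : normedModType R).

(** Directional derivatives are derivatives of functions of one real variable;
    this lets the chain rule and the fundamental theorem of calculus for functions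
    of one variable act on partial derivatives. *)
Lemma is_derive_line (f : V -> R^o) (x v : V) (t : R) (df : R) :
  is_derive t (1 : R) (fun s : R => f (s *: v + x)) df <->
  is_derive (t *: v + x) v f df.
Proof.
have E : (fun h : R => h^-1 *: (((fun s : R => f (s *: v + x)) \o shift t) (h *: (1 : R)) -
      (fun s : R => f (s *: v + x)) t)) =
    (fun h : R => h^-1 *: ((f \o shift (t *: v + x)) (h *: v) - f (t *: v + x))).
  apply/funext => h /=; congr (_ *: (f _ - _)).
  by rewrite [_%:A]mulr1 scalerDl addrA.
by split=> -[fd fv]; split; move: fd fv; rewrite /derivable /derive E.
Qed.

End directional_derivatives_along_lines.

Section smooth_functions.
Context (R : realType) (d : nat).
Implicit Types (f g : 'rV[R]_d -> R) (x : 'rV[R]_d) (i j : 'I_d).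

Local Notation e i := (delta_mx 0 i : 'rV[R]_d).

Lemma is_derive_flat_coord P j a b i x :
  is_derive x (e i) (fun z : 'rV[R]_d => flat P (a * z 0 j + b) : R^o)
    ((i == j)%:R * a * flat ((P - P^`()) * 'X^2) (a * x 0 j + b)).
Proof.
rewrite -[X in is_derive X](add0r x) -[X in is_derive (X + _)](scale0r (e i)).
apply/is_derive_line.
have -> : (fun s : R => flat P (a * (s *: e i + x) 0 j + b)) =
    flat P \o (fun s => ((i == j)%:R * a) * s + (a * x 0 j + b)).
  apply/funext => s /=; congr flat; rewrite !mxE eqxx /= eq_sym; ring.
set c := (_ * a); set b' := (a * x 0 j + b).
have dl : is_derive (0 : R) (1 : R) (fun s : R => c * s + b') c.
  have dl := is_deriveD (is_deriveZ c (is_derive_id (0 : R^o) 1)) (is_derive_cst (b' : R^o) (0 : R^o) 1).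
  by refine (@is_derive_eq _ _ _ _ _ _ _ _ dl _); rewrite addr0 [_%:A]mulr1.
have df : is_derive (c * 0 + b') (1 : R) (flat P : R -> R) (flat ((P - P^`()) * 'X^2) b').
  by rewrite mulr0 add0r; exact: is_derive_flat.
by have := @is_derive1_comp R (flat P) (fun s : R => c * s + b') 0 _ _ df dl; rewrite [in X in X -> _]mulrC.
Qed.

(** An algebra of functions closed under partial derivatives, so that smoothness
    of its elements follows from continuity and derivability alone. *)
Inductive flat_algebra : ('rV[R]_d -> R) -> Prop :=
| flat_algebra_coord P j a b : flat_algebra (fun x => flat P (a * x 0 j + b))
| flat_algebra_cst c : flat_algebra (fun=> c)
| flat_algebraD f g : flat_algebra f -> flat_algebra g ->
    flat_algebra (fun x => f x + g x)
| flat_algebraM f g : flat_algebra f -> flat_algebra g ->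
    flat_algebra (fun x => f x * g x).

Lemma flat_algebra_continuous f : flat_algebra f -> continuous f.
Proof.
elim=> {f} [P j a b|c|f g _ cf _ cg|f g _ cf _ cg] x.
- apply: (@continuous_comp _ _ _ (fun z : 'rV[R]_d => z 0 j) (fun t => flat P (a * t + b))).
    exact: coord_continuous.
  apply: (@continuous_comp _ _ _ (fun t => a * t + b) (flat P)); last exact: continuous_flat.
  by apply: cvgD; [apply: cvgM; [exact: cvg_cst|exact: cvg_id]|exact: cvg_cst].
- exact: cst_continuous.
- exact: (continuousD (cf x) (cg x)).
- exact: (continuousM (cf x) (cg x)).
Qed.

Lemma flat_algebra_partial f : flat_algebra f -> forall i,
  (forall x, derivable (f : _ -> R^o) x (e i)) /\ flat_algebra (partial i f).
Proof.
elim=> {f} [P j a b|c|f g Af If Ag Ig|f g Af If Ag Ig] i.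
- split; first by move=> x; case: (is_derive_flat_coord P j a b i x).
  rewrite (_ : partial _ _ = fun x =>
      (i == j)%:R * a * flat ((P - P^`()) * 'X^2) (a * x 0 j + b)).
    by apply: flat_algebraM; [exact: flat_algebra_cst|exact: flat_algebra_coord].
  by apply/funext => x; case: (is_derive_flat_coord P j a b i x).
- split; first by move=> x; exact: derivable_cst.
  rewrite (_ : partial _ _ = fun=> 0); first exact: flat_algebra_cst.
  by apply/funext => x; exact: derive_cst.
- have [df Af'] := If i; have [dg Ag'] := Ig i.
  split; first by move=> x; exact: derivableD.
  rewrite (_ : partial _ _ = fun x => partial i f x + partial i g x).
    exact: flat_algebraD.
  by apply/funext => x; exact: deriveD.
- have [df Af'] := If i; have [dg Ag'] := Ig i.
  split; first by move=> x; exact: derivableM.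
  rewrite (_ : partial _ _ = fun x => f x * partial i g x + g x * partial i f x).
    by apply: flat_algebraD; exact: flat_algebraM.
  by apply/funext => x; exact: deriveM.
Qed.

Lemma flat_algebra_smooth f : flat_algebra f -> smooth f.
Proof.
move=> Af s; suff As : flat_algebra (foldr (@partial R d) f s).
  split; first exact: flat_algebra_continuous.
  by move=> i; exact: (flat_algebra_partial As i).1.
by elim: s => //= i s As; exact: (flat_algebra_partial As i).2.
Qed.

Lemma flat_algebra_prod (I : Type) (s : seq I) (F : I -> 'rV[R]_d -> R) :
  (forall l, flat_algebra (F l)) -> flat_algebra (fun x => \prod_(l <- s) F l x).
Proof.
move=> AF; elim: s => [|l s As].
  rewrite (_ : (fun _ => _) = fun=> 1); first exact: flat_algebra_cst.
  by apply/funext => x; rewrite big_nil.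
rewrite (_ : (fun _ => _) = fun x => F l x * \prod_(k <- s) F k x).
  exact: flat_algebraM.
by apply/funext => x; rewrite big_cons.
Qed.

Definition obox (a b : 'rV[R]_d) := [set x : 'rV[R]_d | forall i, a 0 i < x 0 i < b 0 i].
Definition cbox (a b : 'rV[R]_d) := [set x : 'rV[R]_d | forall i, a 0 i <= x 0 i <= b 0 i].

(** In each coordinate this is exp(-1/((k+1)(x_i - a_i)) - 1/((k+1)(b_i - x_i)))
    inside the box, see [box_bumpE]; the arguments are written as affine functions
    of x_i to fit [flat_algebra_coord]. *)
Definition box_bump (a b : 'rV[R]_d) (k : nat) (x : 'rV[R]_d) : R :=
  \prod_(i <- index_enum 'I_d) (flat 1 (k.+1%:R * x 0 i + (- k.+1%:R * a 0 i)) *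
                 flat 1 (- k.+1%:R * x 0 i + k.+1%:R * b 0 i)).

Lemma box_bumpE a b k x : box_bump a b k x =
  \prod_(i <- index_enum 'I_d) (flat 1 (k.+1%:R * (x 0 i - a 0 i)) *
                 flat 1 (k.+1%:R * (b 0 i - x 0 i))).
Proof.
by apply: eq_bigr => i _; congr (flat _ _ * flat _ _); ring.
Qed.

Lemma box_bump_itv a b k x : 0 <= box_bump a b k x <= 1.
Proof.
rewrite box_bumpE; apply: (big_ind (fun r => 0 <= r <= 1)); first by rewrite ler01 lexx.
  by move=> r s /andP[r0 r1] /andP[s0 s1]; rewrite mulr_ge0//= mulr_ile1.
move=> i _; have /andP[r0 r1] := flat1_itv (k.+1%:R * (x 0 i - a 0 i)).
by have /andP[s0 s1] := flat1_itv (k.+1%:R * (b 0 i - x 0 i)); rewrite mulr_ge0//= mulr_ile1.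
Qed.

Lemma box_bump_out a b k x : ~ obox a b x -> box_bump a b k x = 0.
Proof.
move=> /existsNP[i abx]; rewrite box_bumpE (bigD1_seq i) ?mem_index_enum ?index_enum_uniq//=.
case: (ltP (a 0 i) (x 0 i)) => ax; last first.
  by rewrite (@flat_le0 _ _ (_ * (x 0 i - _))) ?mul0r// pmulr_rle0 ?subr_le0.
case: (ltP (x 0 i) (b 0 i)) => bx; first by case: abx; rewrite ax.
by rewrite (@flat_le0 _ _ (_ * (b 0 i - _))) ?mulr0 ?mul0r// pmulr_rle0 ?subr_le0.
Qed.

Lemma box_bump_cvg a b x : box_bump a b k x @[k --> \oo] --> (\1_(obox a b) x : R).
Proof.
rewrite indicE; have [/set_mem abx|/negP abx] := boolP (x \in obox a b); last first.
  rewrite (_ : (fun _ => _) = fun=> 0); first exact: cvg_cst.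
  by apply/funext => k; rewrite box_bump_out// => /mem_set.
have H s : \prod_(i <- s) (flat 1 (k.+1%:R * (x 0 i - a 0 i)) *
    flat 1 (k.+1%:R * (b 0 i - x 0 i))) @[k --> \oo] --> (1 : R).
  elim: s => [|i s IH].
    by rewrite (_ : (fun _ => _) = fun=> 1); [exact: cvg_cst|apply/funext => k; rewrite big_nil].
  rewrite (_ : (fun _ => _) = fun k => (flat 1 (k.+1%:R * (x 0 i - a 0 i)) *
      flat 1 (k.+1%:R * (b 0 i - x 0 i))) * \prod_(i <- s) (flat 1 (k.+1%:R * (x 0 i - a 0 i)) *
      flat 1 (k.+1%:R * (b 0 i - x 0 i)))); last by apply/funext => k; rewrite big_cons.
  have /andP[ax bx] := abx i.
  rewrite -[X in _ --> X]mulr1; apply: cvgM IH; rewrite -[X in _ --> X]mulr1.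
  by apply: cvgM; apply: flat1_scaled_cvg; rewrite subr_gt0.
rewrite (_ : (fun _ => _) = fun k => \prod_(i <- index_enum 'I_d)
   (flat 1 (k.+1%:R * (x 0 i - a 0 i)) * flat 1 (k.+1%:R * (b 0 i - x 0 i)))).
  exact: H.
by apply/funext => k; rewrite box_bumpE.
Qed.

Lemma cbox_compact a b : compact (cbox a b).
Proof.
apply: (@rV_compact _ _ (fun i => `[a 0 i, b 0 i]%classic)) => i.
exact: segment_compact.
Qed.

Lemma obox_sub_cbox a b : obox a b `<=` cbox a b.
Proof. by move=> x abx i; have /andP[/ltW-> /ltW->] := abx i. Qed.

Lemma box_bump_test (Omega : set 'rV[R]_d) a b k : cbox a b `<=` Omega ->
  test_function Omega (box_bump a b k).
Proof.
move=> abO; split.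
  apply: flat_algebra_smooth; apply: flat_algebra_prod => i.
  by apply: flat_algebraM; exact: flat_algebra_coord.
exists (cbox a b); split => //; first exact: cbox_compact.
by move=> x abx; apply: box_bump_out => /obox_sub_cbox.
Qed.

End smooth_functions.

(** * Boxes, cubes and the fundamental lemma of the calculus of variations *)

Section boxes.
Context (R : realType) (d : nat).
Implicit Types (a b x : 'rV[R]_d) (A Omega : set 'rV[R]_d).

Lemma continuous_measurable_rV (f : 'rV[R]_d -> R) : continuous f ->
  measurable_fun setT f.
Proof.
move=> cf; apply: (measurability _ (measurable_realfun.RGenOpens.measurableE R)).
move=> _ [_ [a [b ->]] <-].
rewrite setTI; apply: open_measurable_rV.
by apply: open_comp; [move=> x _; exact: cf|exact: interval_open].
Qed.

Lemma measurable_obox a b : measurable (obox a b).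
Proof.
rewrite (_ : obox a b = \bigcap_(i in [set: 'I_d])
    ((fun x => x 0 i) @^-1` `]a 0 i, b 0 i[)).
  apply: fin_bigcap_measurable => // i _.
  by rewrite -[X in measurable X]setTI; exact: measurable_coord.
apply/seteqP; split => [x abx i _ /=|x abx i]; first by rewrite in_itv; exact: abx.
by have := abx i I; rewrite /= in_itv.
Qed.

Lemma measurable_cbox a b : measurable (cbox a b).
Proof.
rewrite (_ : cbox a b = \bigcap_(i in [set: 'I_d])
    ((fun x => x 0 i) @^-1` `[a 0 i, b 0 i])).
  apply: fin_bigcap_measurable => // i _.
  by rewrite -[X in measurable X]setTI; exact: measurable_coord.
apply/seteqP; split => [x abx i _ /=|x abx i]; first by rewrite in_itv; exact: abx.
by have := abx i I; rewrite /= in_itv.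
Qed.

Lemma oboxI a b a' b' : obox a b `&` obox a' b' =
  obox (\row_i Num.max (a 0 i) (a' 0 i)) (\row_i Num.min (b 0 i) (b' 0 i)).
Proof.
apply/seteqP; split => [x [h h'] i|x h].
  have /andP[h1 h2] := h i; have /andP[h3 h4] := h' i.
  by rewrite !mxE gt_max lt_min h1 h2 h3 h4.
by split => i; have := h i; rewrite !mxE gt_max lt_min => /andP[/andP[h1 h2] /andP[h3 h4]];
  apply/andP.
Qed.

Definition rat_obox (q : 'rV[rat]_d * 'rV[rat]_d) : set 'rV[R]_d :=
  obox (map_mx ratr q.1) (map_mx ratr q.2).
Definition rat_cbox (q : 'rV[rat]_d * 'rV[rat]_d) : set 'rV[R]_d :=
  cbox (map_mx ratr q.1) (map_mx ratr q.2).

Lemma open_rat_box Omega x : open Omega -> Omega x ->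
  exists q, rat_obox q x /\ rat_cbox q `<=` Omega.
Proof.
move=> oO Ox; have /nbhs_ballP[e /= e0 eO] := open_nbhs_nbhs (conj oO Ox).
have hq (i : 'I_d) : exists q : rat * rat,
    x 0 i - e < ratr q.1 < x 0 i /\ x 0 i < ratr q.2 < x 0 i + e.
  have : x 0 i - e < x 0 i by rewrite ltrBlDr ltrDl.
  move=> /rat_in_itvoo[q]; rewrite in_itv /= => q1.
  have : x 0 i < x 0 i + e by rewrite ltrDl.
  move=> /rat_in_itvoo[r]; rewrite in_itv /= => r1.
  by exists (q, r).
have [q qE] := choice hq.
exists (\row_i (q i).1, \row_i (q i).2); split.
  by move=> i; rewrite !mxE; have [/andP[_ ->] /andP[->]] := qE i.
move=> y qy; apply: eO; split => // i j; rewrite ord1 /ball /=.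
have := qy j; rewrite !mxE => /andP[qy1 qy2].
have [/andP[h1 h2] /andP[h3 h4]] := qE j.
by rewrite ltr_distl; apply/andP; split; lra.
Qed.

(** Boxes, unlike general open sets, are easy to approximate by
    test functions and stable under intersection. *)
Lemma borel_obox : @measurable _ 'rV[R]_d = <<s [set A | exists a b, A = obox a b] >>.
Proof.
apply/seteqP; split; last first.
  apply: smallest_sub; first exact: sigma_algebra_measurable.
  by move=> _ [a [b ->]]; exact: measurable_obox.
apply: smallest_sub; first exact: smallest_sigma_algebra.
move=> A oA.
pose G := [set A : set 'rV[R]_d | exists a b, A = obox a b].
have -> : A = \bigcup_q (if `[< rat_cbox q `<=` A >] then rat_obox q else set0).
  apply/seteqP; split => [x Ax|x [q _]]; last first.
    by case: asboolP => // qA /obox_sub_cbox /qA.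
  by have [q [qx qA]] := open_rat_box oA Ax; exists q => //; case: asboolP.
apply: (@countable_bigcupT_measurable _ (g_sigma_algebraType G)) => [|q].
  exact: countableP.
case: asboolP => _; last exact: (@measurable0 _ (g_sigma_algebraType G)).
by apply: sub_sigma_algebra; eexists; eexists.
Qed.

End boxes.

Section cubes.
Context (R : realType).

Definition cube (d : nat) (M : R) : set 'rV[R]_d :=
  cbox (const_mx (- M)) (const_mx M).
Arguments cube : clear implicits.

Lemma cubeP d M (x : 'rV[R]_d) : cube d M x <-> forall i, `|x 0 i| <= M.
Proof. by split=> h i; have := h i; rewrite !mxE ler_norml. Qed.

Lemma closed_cube d M : closed (cube d M).
Proof. by apply: compact_closed; [exact: norm_hausdorff|exact: cbox_compact]. Qed.

Lemma bounded_sub_cube d (A : set 'rV[R]_d) : bounded_set A -> exists M, A `<=` cube d M.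
Proof.
move=> [M [_ AM]]; exists (M + 1) => x Ax; apply/cubeP => i.
apply: le_trans (AM (M + 1) _ x Ax); last by rewrite ltrDl.
rewrite [leRHS]/Num.norm /= mx_normrE.
by apply/bigmax_geP; right => /=; exists (0, i).
Qed.

Lemma cube_finite_measure d (M : R) : (lebesgue_rV R d (cube d M) < +oo)%E.
Proof.
elim: d => [|d IH].
  by rewrite /= /dirac ltry.
rewrite /= /lebesgue_rV_succ /pushforward.
rewrite (_ : _ @^-1` _ = `[- M, M] `*` cube d M).
  rewrite product_measure1E//; last exact: measurable_cbox.
  have MM : (lebesgue_measure [set` `[(- M)%R, M]] < +oo)%E.
    by rewrite lebesgue_measure_itv /=; case: ifPn => // _; rewrite -EFinB ltry.
  by rewrite lte_mul_pinfty// ge0_fin_numE.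
apply/seteqP; split => [[t z] /= h|[t z] [/= h1 h2] i].
  split => /=; first by have := h 0; rewrite cons_rV0 !mxE in_itv.
  by move=> i; have := h (lift ord0 i); rewrite cons_rVS !mxE.
case: (unliftP ord0 i) => [j|] ->; last by rewrite cons_rV0 !mxE.
by rewrite cons_rVS; have := h2 j; rewrite !mxE.
Qed.

Lemma bounded_finite_measure d (A : set 'rV[R]_d) :
  measurable A -> bounded_set A -> (lebesgue_rV R d A < +oo)%E.
Proof.
move=> mA /bounded_sub_cube[M AM].
apply: le_lt_trans (cube_finite_measure d M).
by apply: le_measure; rewrite ?inE//; exact: measurable_cbox.
Qed.

End cubes.
Arguments cube {R} d M.

Section fundamental_lemma.
Context (R : realType) (d : nat).
Local Notation leb := (lebesgue_rV R d).
Implicit Types (a b x : 'rV[R]_d) (A Omega : set 'rV[R]_d).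

(** The bump functions of the box converge boundedly to its indicator, and their
    supports lie in [Omega]; dominated convergence concludes. *)
Lemma orthogonal_to_tests_box Omega (h : 'rV[R]_d -> R) a b : open Omega ->
  leb.-integrable Omega (EFin \o h) ->
  (forall eta, test_function Omega eta -> \int[leb]_(x in Omega) (h x * eta x) = 0) ->
  cbox a b `<=` Omega -> (\int[leb]_(x in obox a b) (h x)%:E = 0)%E.
Proof.
move=> oO hi horth abO.
have mO : measurable Omega by exact: open_measurable_rV.
have mh := measurable_int _ hi.
have mab := measurable_obox a b.
pose F k x := (h x * box_bump a b k x)%:E.
have mF k : measurable_fun Omega (F k).
  apply/measurable_EFinP; apply: measurable_funM; first exact/measurable_EFinP.
  apply: measurable_funTS; apply: continuous_measurable_rV.
  by have [/(_ [::])[]] := box_bump_test k abO.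
have IF k : (\int[leb]_(x in Omega) F k x = 0)%E.
  suff fI : (\int[leb]_(x in Omega) F k x)%E \is a fin_num.
    by rewrite -(fineK fI); congr EFin; exact: horth (box_bump_test k abO).
  apply: integrable_fin_num => //; apply: (le_integrable mO _ _ hi); first exact: mF.
  move=> x _; rewrite /= normrM lee_fin ler_piMr//.
  by have /andP[h0 h1] := box_bump_itv a b k x; rewrite ger0_norm.
have [||||_ _ cv] := @dominated_convergence _ _ _ leb Omega mO F (fun x => (h x * \1_(obox a b) x)%:E)
  (fun x => `|(h x)%:E|)%E mF.
- apply/measurable_EFinP; apply: measurable_funM; first exact/measurable_EFinP.
  exact: measurable_indic.
- apply: aeW => x _; apply: cvg_EFin; first exact: nearW.
  by apply: cvgM; [exact: cvg_cst|exact: box_bump_cvg].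
- exact: integrable_abse.
- apply: aeW => x k _; rewrite /= lee_fin normrM ler_piMr//.
  by have /andP[h0' h1] := box_bump_itv a b k x; rewrite ger0_norm.
move: cv; rewrite (_ : (fun k => _) = fun=> 0%E); last by apply/funext => k; rewrite IF.
move=> cv.
transitivity (\int[leb]_(x in Omega) (h x * \1_(obox a b) x)%:E)%E.
  have abO' : obox a b `<=` Omega by exact: subset_trans (@obox_sub_cbox _ _ a b) abO.
  rewrite -[in LHS](setIidr abO') integral_mkcondr.
  apply: eq_integral => x _; rewrite patchE indicE; case: ifPn => xab /=.
    by rewrite mulr1.
  by rewrite mulr0.
apply: esym; have h0 : (fun=> 0%E) @ \oo --> (0%E : \bar R) by exact: cvg_cst.
exact: (cvg_unique _ h0 cv).
Qed.

(** Dynkin's induction from boxes to Borel sets.  Everything is intersected with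
    one fixed box inside [Omega], since test functions only see compact parts of
    [Omega]. *)
Lemma orthogonal_to_tests_borel Omega (h : 'rV[R]_d -> R) a b A : open Omega ->
  leb.-integrable Omega (EFin \o h) ->
  (forall eta, test_function Omega eta -> \int[leb]_(x in Omega) (h x * eta x) = 0) ->
  cbox a b `<=` Omega -> measurable A ->
  (\int[leb]_(x in A `&` obox a b) (h x)%:E = 0)%E.
Proof.
move=> oO hi horth abO.
have mO : measurable Omega by exact: open_measurable_rV.
have mab := measurable_obox a b.
have abO' : obox a b `<=` Omega by exact: subset_trans (@obox_sub_cbox _ _ a b) abO.
have hiA B : measurable B -> leb.-integrable (B `&` obox a b) (EFin \o h).
  move=> mB; apply: integrableS hi => //; first exact: measurableI.
  by move=> x [_ /abO'].
rewrite [X in X A -> _]borel_obox.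
move: A; apply: dynkin_induction.
- exact: borel_obox.
- move=> _ _ [a1 [b1 ->]] [a2 [b2 ->]]; rewrite oboxI; by eexists; eexists.
- rewrite setTI; exact: orthogonal_to_tests_box horth abO.
- move=> _ [a1 [b1 ->]]; rewrite oboxI.
  apply: orthogonal_to_tests_box horth _ => // x h1; apply: abO => i.
  by have := h1 i; rewrite !mxE ge_max le_min => /andP[/andP[_ ->] /andP[_ ->]].
- move=> B mB IB.
  have := @integral_setU _ _ _ leb (B `&` obox a b) (~` B `&` obox a b) (EFin \o h).
  rewrite -setIUl setUv setTI (orthogonal_to_tests_box oO hi horth abO) IB add0e => <- //.
  + exact: measurableI.
  + by apply: measurableI => //; exact: measurableC.
  + exact: measurable_funS (measurable_int _ hi).
  + by apply/disj_set2P; rewrite setIACA setICr set0I.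
- move=> F mF tF IF; rewrite setI_bigcupl integral_bigcup//.
  + by rewrite eseries0// => k _ _; exact: IF.
  + exact: trivIset_setIr.
  + by move=> k; exact: measurableI.
  + by rewrite -setI_bigcupl; apply: hiA; exact: bigcupT_measurable.
Qed.

(** On each box with rational corners whose closure lies in [Omega], the function
    has zero integral over every Borel subset and hence vanishes almost everywhere;
    countably many such boxes cover [Omega]. *)
Lemma fundamental_lemma Omega (h : 'rV[R]_d -> R) : open Omega ->
  ae_integrable leb Omega h ->
  (forall eta, test_function Omega eta -> \int[leb]_(x in Omega) (h x * eta x) = 0) ->
  ae_eq leb Omega h (fun=> 0).
Proof.
move=> oO [g gi hg] horth; apply: (ae_eq_trans hg).
have {}horth eta : test_function Omega eta -> \int[leb]_(x in Omega) (g x * eta x) = 0.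
  move=> teta; rewrite -(horth _ teta); apply: ae_eq_Rintegral.
  by apply: filterS hg => x hg Dx; rewrite hg.
have qP (q : 'rV[rat]_d * 'rV[rat]_d) :
    {ae leb, forall x, rat_cbox q `<=` Omega -> rat_obox q x -> g x = 0}.
  have [qO|qO] := pselect (@rat_cbox R d q `<=` Omega); last exact: aeW.
  have qO' : rat_obox q `<=` Omega by exact: subset_trans (@obox_sub_cbox _ _ _ _) qO.
  have mq : measurable (@rat_obox R d q) by exact: measurable_obox.
  have := @integral_ae_eq _ _ _ leb (rat_obox q) mq (cst 0%E) (EFin \o g).
  move=> H; have : ae_eq leb (rat_obox q) (EFin \o g) (cst 0%E).
    apply: H.
    - by apply: integrableS gi => //; exact: open_measurable_rV.
    - exact: measurable_cst.
    - move=> E Eq mE; rewrite integral0 -(setIidl Eq).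
      exact: (orthogonal_to_tests_borel oO gi horth qO mE).
  by apply: filterS => x + _ xq => /(_ xq) [].
have := ae_forall_countable qP; apply: filterS => x xP Ox.
by have [q [xq qO]] := open_rat_box oO Ox; exact: xP xq.
Qed.

End fundamental_lemma.

(** * The integral of a partial derivative *)

Section integral_of_partial.
Context (R : realType).

Lemma integrable_continuous_compact_support d (M : R) (f : 'rV[R]_d -> R) :
  continuous f -> (forall x, ~ cube d M x -> f x = 0) ->
  (lebesgue_rV R d).-integrable setT (EFin \o f).
Proof.
move=> cf f0.
have mM : measurable (cube d M) by exact: measurable_cbox.
rewrite (_ : _ \o _ = (EFin \o f) \_ (cube d M)); last first.
  apply/funext => x; rewrite patchE; case: ifPn => // /negP xM /=.
  by rewrite f0// => /mem_set.
apply: (integrable_mkcond _ mM).1; apply: measurable_bounded_integrable => //.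
- exact: cube_finite_measure.
- by apply: measurable_funTS; exact: continuous_measurable_rV.
- have : compact (f @` cube d M).
    apply: continuous_compact; last exact: cbox_compact.
    exact: continuous_subspaceT.
  move=> /(@compact_bounded _ R^o) [N [Nr NP]]; exists N; split => // L /NP fL x Mx.
  by apply: fL; exists x.
Qed.

Lemma partial_out_of_support d (M : R) (i : 'I_d) (f : 'rV[R]_d -> R) :
  (forall x, ~ cube d M x -> f x = 0) -> forall x, ~ cube d M x -> partial i f x = 0.
Proof.
move=> f0 x xM; rewrite /partial (@near_eq_derive _ _ R^o f (cst 0)) ?derive_cst//.
have /open_nbhs_nbhs : open_nbhs x (~` cube d M).
  by split => //; apply: closed_openC; exact: closed_cube.
by apply: filterS => z /f0.
Qed.

Lemma cons_rV_line0 n (t : R) (z : 'rV[R]_n) :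
  cons_rV (t, z) = t *: delta_mx 0 0 + cons_rV (0, z).
Proof.
apply/rowP => k; rewrite [RHS]mxE [X in _ = X + _]mxE [X in _ = _ * X + _]mxE eqxx /=.
case: (unliftP ord0 k) => [j|] ->; first by rewrite !cons_rVS /= mulr0 add0r.
by rewrite !cons_rV0 /= mulr1 addr0.
Qed.

Lemma cons_rV_lineS n (t s : R) (z : 'rV[R]_n) (j : 'I_n) :
  cons_rV (t, s *: delta_mx 0 j + z) = s *: delta_mx 0 (lift ord0 j) + cons_rV (t, z).
Proof.
apply/rowP => k; rewrite [RHS]mxE [X in _ = X + _]mxE [X in _ = _ * X + _]mxE eqxx /=.
case: (unliftP ord0 k) => [l|] ->.
  by rewrite !cons_rVS /= !mxE eqxx /= (inj_eq lift_inj).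
by rewrite !cons_rV0 /= mulr0 add0r.
Qed.

Lemma continuous_cons_rV_line0 n (z : 'rV[R]_n) : continuous (fun t : R => cons_rV (t, z)).
Proof.
rewrite (_ : (fun _ => _) = fun t => t *: delta_mx 0 0 + cons_rV (0, z)); last first.
  by apply/funext => t; exact: cons_rV_line0.
move=> t; apply: cvgD; last exact: cvg_cst.
by apply: cvgZr_tmp; exact: cvg_id.
Qed.

Lemma continuous_cons_rV_snd n (t : R) : continuous (fun z : 'rV[R]_n => cons_rV (t, z)).
Proof.
move=> z; apply: (@cvg_ballP R _ _ (nbhs z) _ (fun z' => cons_rV (t, z')) (cons_rV (t, z))).2 => e e0.
near=> z'; split => // i k; rewrite ord1.
have zz : ball z e z' by near: z'; exact: nbhsx_ballx.
case: (unliftP ord0 k) => [l|] ->; last by rewrite !cons_rV0; exact: ballxx.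
by rewrite !cons_rVS /=; case: zz.
Unshelve. all: by end_near. Qed.

(** The product measure behind one step of the recursive definition of
    [lebesgue_rV], bundled as a measure so that Fubini's theorem applies to it. *)
Definition prod_lebesgue_rV n : {measure set (measurableTypeR R * 'rV[R]_n) -> \bar R} :=
  (@lebesgue_measure R \x lebesgue_rV R n)%E.

Lemma integral_lebesgue_rV_succ n (f : 'rV[R]_n.+1 -> R) (M : R) : continuous f ->
  (forall x, ~ cube n.+1 M x -> f x = 0) ->
  [/\ (prod_lebesgue_rV n).-integrable setT (EFin \o f \o @cons_rV R n) &
  (\int[lebesgue_rV R n.+1]_x (f x)%:E =
   \int[prod_lebesgue_rV n]_z (f (cons_rV z))%:E)%E].
Proof.
move=> cf f0; have fi := integrable_continuous_compact_support cf f0.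
have mf : measurable_fun setT (EFin \o f) by exact: measurable_int fi.
have mc : measurable_fun [set: measurableTypeR R * 'rV[R]_n] (@cons_rV R n).
  exact: measurable_cons_rV.
have fci : (prod_lebesgue_rV n).-integrable setT (EFin \o f \o @cons_rV R n).
  apply/integrableP; split.
    exact: measurableT_comp.
  move/integrableP : fi => [_]; apply: le_lt_trans.
  have := @ge0_integral_pushforward _ _ _ _ R _ mc
    (prod_lebesgue_rV n) setT (fun x => `|(f x)%:E|)%E measurableT.
  move=> H; rewrite -[leRHS]/(\int[pushforward (prod_lebesgue_rV n) (@cons_rV R n)]_x `|(f x)%:E|)%E H//.
  exact: measurableT_comp.
split => //.
exact: (@integral_pushforward _ _ _ _ R _ mc
    (prod_lebesgue_rV n) setT (EFin \o f) mf fci measurableT).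
Qed.

Lemma integral_derivative_compact_support (g g' : R -> R) (M : R) :
  (forall t, is_derive t (1 : R) g (g' t)) -> continuous g' ->
  (forall t, M < `|t| -> g t = 0) -> (forall t, M < `|t| -> g' t = 0) ->
  (\int[lebesgue_measure]_t (g' t)%:E = 0)%E.
Proof.
move=> dg cg' g0 g'0.
have N0 : 0 < `|M| + 1 by rewrite ltr_wpDl.
have MN : M < `|M| + 1 by rewrite (le_lt_trans (ler_norm M))// ltrDl.
have gN : g (`|M| + 1) = 0 by apply: g0; rewrite gtr0_norm.
have gNN : g (- (`|M| + 1)) = 0 by apply: g0; rewrite normrN gtr0_norm.
have cg : continuous g.
  move=> t; apply/differentiable_continuous/derivable1_diffP.
  by case: (dg t).
have := @continuous_FTC2 R g' g (- (`|M| + 1)) (`|M| + 1).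
rewrite gN gNN subee// => FTC.
have <- : (\int[lebesgue_measure]_(t in `[(- (`|M| + 1))%R, (`|M| + 1)%R]) (g' t)%:E = 0)%E.
  apply: FTC.
  - by rewrite gtrN.
  - exact: continuous_subspaceT.
  - split; first by move=> t _; case: (dg t).
    + by apply: cvg_at_right_filter; exact: cg.
    + by apply: cvg_at_left_filter; exact: cg.
  - by move=> t _; rewrite derive1E; case: (dg t).
rewrite [RHS]integral_mkcond; apply: eq_integral => t _; rewrite patchE.
case: ifPn => // /negP tM; rewrite g'0//.
rewrite ltNge; apply/negP => tM'; apply: tM; apply/mem_set => /=.
by rewrite in_itv/= -ler_norml (le_trans tM')// ltW.
Qed.

(** Induction on the dimension, by Fubini.  For the first coordinate the inner
    integral is over the line, where it vanishes by the fundamental theorem of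
    calculus; for any other coordinate the inner integral is over the remaining
    coordinates, where the induction hypothesis applies to the slices of [f]. *)
Lemma integral_partial n (i : 'I_n) (f : 'rV[R]_n -> R) (M : R) :
  (forall x, derivable (f : _ -> R^o) x (delta_mx 0 i)) ->
  continuous (partial i f) ->
  (forall x, ~ cube n M x -> f x = 0) ->
  (\int[lebesgue_rV R n]_x (partial i f x)%:E = 0)%E.
Proof.
elim: n i f => [[]//|n IH i f df cf' f0].
have f'0 := partial_out_of_support i f0.
have [fi ->] := integral_lebesgue_rV_succ cf' f'0.
have out0 t (z : 'rV[R]_n) : M < `|t| -> ~ cube n.+1 M (cons_rV (t, z)).
  by move=> Mt /cubeP /(_ 0); rewrite cons_rV0 /= leNgt Mt.
have outS t (z : 'rV[R]_n) : ~ cube n M z -> ~ cube n.+1 M (cons_rV (t, z)).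
  move=> zM /cubeP h; apply: zM; apply/cubeP => j.
  by have := h (lift ord0 j); rewrite cons_rVS.
move: df cf' f'0 fi; case: (unliftP ord0 i) => [j|] -> df cf' f'0 fi.
  rewrite -[LHS](integral12_prod_meas1 fi).
  rewrite (_ : fubini_F _ _ = cst 0%E) ?integral0//.
  apply/funext => t; rewrite /fubini_F /=.
  have lineS (z : 'rV[R]_n) : is_derive z (delta_mx 0 j) (fun z => f (cons_rV (t, z)) : R^o)
      (partial (lift ord0 j) f (cons_rV (t, z))).
    rewrite -[X in is_derive X](add0r z) -[X in is_derive (X + _)](scale0r (delta_mx 0 j)).
    apply/is_derive_line.
    rewrite (_ : (fun s : R => _) = (fun s : R => f (s *: delta_mx 0 (lift ord0 j) + cons_rV (t, z)))); last first.
      by apply/funext => s; rewrite cons_rV_lineS.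
    apply/is_derive_line; rewrite scale0r add0r; exact: derivableP.
  have fE : partial j (fun z => f (cons_rV (t, z))) = fun z => partial (lift ord0 j) f (cons_rV (t, z)).
    by apply/funext => z; rewrite /partial; case: (lineS z).
  transitivity (\int[lebesgue_rV R n]_z (partial j (fun z => f (cons_rV (t, z))) z)%:E)%E.
    by rewrite fE.
  apply: IH.
  - by move=> z; case: (lineS z).
  - rewrite fE => z; apply: (@continuous_comp _ _ _ (fun z : 'rV[R]_n => cons_rV (t, z))).
      exact: continuous_cons_rV_snd.
    exact: cf'.
  - by move=> z zM; apply: f0; exact: outS.
rewrite -[LHS](integral21_prod_meas1 fi).
rewrite (_ : fubini_G _ _ = cst 0%E) ?integral0//.
apply/funext => z; rewrite /fubini_G /=.
apply: (@integral_derivative_compact_support (fun t => f (cons_rV (t, z))) _ M).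
- move=> t.
  rewrite (_ : (fun t : R => _) = (fun t : R => f (t *: delta_mx 0 ord0 + cons_rV (0, z)))); last first.
    by apply/funext => s; rewrite cons_rV_line0.
  apply/is_derive_line; rewrite -cons_rV_line0; exact: derivableP.
- move=> t; apply: (@continuous_comp _ _ _ (fun t : R => cons_rV (t, z))).
    exact: continuous_cons_rV_line0.
  exact: cf'.
- by move=> t Mt; apply: f0; exact: out0.
- by move=> t Mt; apply: f'0; exact: out0.
Qed.

End integral_of_partial.

(** * Test functions and Sobolev spaces *)

Section test_functions.
Context (R : realType) (d : nat) (Omega : set 'rV[R]_d).
Local Notation leb := (lebesgue_rV R d).
Implicit Types (f g eta zeta : 'rV[R]_d -> R) (i : 'I_d).

Lemma smooth_partial i eta : smooth eta -> smooth (partial i eta).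
Proof. by move=> se s; have := se (rcons s i); rewrite foldr_rcons. Qed.

Lemma smooth_continuous eta : smooth eta -> continuous eta.
Proof. by move=> /(_ [::]) []. Qed.

Lemma smooth_derivable eta : smooth eta ->
  forall i x, derivable (eta : _ -> R^o) x (delta_mx 0 i).
Proof. by move=> /(_ [::]) []. Qed.

Lemma smoothB eta zeta : smooth eta -> smooth zeta -> smooth (fun x => eta x - zeta x).
Proof.
move=> se sz s.
have sE : forall s e z, smooth e -> smooth z -> foldr (@partial R d) (fun x => e x - z x) s =
    fun x => foldr (@partial R d) e s x - foldr (@partial R d) z s x.
  elim/last_ind => // {}s i IH e z he hz; rewrite !foldr_rcons -IH; [|exact: smooth_partial..].
  congr foldr; apply/funext => x.
  by apply: deriveB; exact: smooth_derivable.
rewrite sE//; have [ce de] := se s; have [cz dz] := sz s; split.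
  by move=> x; exact: (continuousB (ce x) (cz x)).
by move=> i x; exact: (derivableB (de i x) (dz i x)).
Qed.

Lemma test_out eta : test_function Omega eta -> forall x, ~ Omega x -> eta x = 0.
Proof. by move=> [_ [C [_ CO e0]]] x Ox; apply: e0 => /CO. Qed.

Lemma test_cube eta : test_function Omega eta ->
  exists M, forall x, ~ cube d M x -> eta x = 0.
Proof.
move=> [_ [C [cC _ e0]]]; have [M CM] := bounded_sub_cube (compact_bounded cC).
by exists M => x xM; apply: e0 => /CM.
Qed.

Lemma test_partial i eta : test_function Omega eta -> test_function Omega (partial i eta).
Proof.
move=> [se [C [cC CO e0]]]; split; first exact: smooth_partial.
exists C; split => // x Cx; rewrite /partial (@near_eq_derive _ _ R^o eta (cst 0)) ?derive_cst//.
have /open_nbhs_nbhs : open_nbhs x (~` C).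
  by split => //; apply/closed_openC; apply: compact_closed cC; exact: norm_hausdorff.
by apply: filterS => z /e0.
Qed.

Lemma testB eta zeta : test_function Omega eta -> test_function Omega zeta ->
  test_function Omega (fun x => eta x - zeta x).
Proof.
move=> [se [C [cC CO e0]]] [sz [D [cD DO z0]]]; split; first exact: smoothB.
exists (C `|` D); split; first exact: compactU.
  by move=> x [/CO|/DO].
by move=> x /not_orP[Cx Dx]; rewrite e0// z0// subrr.
Qed.

Lemma partialB i eta zeta : smooth eta -> smooth zeta ->
  partial i (fun x => eta x - zeta x) = fun x => partial i eta x - partial i zeta x.
Proof. by move=> se sz; apply/funext => x; apply: deriveB; exact: smooth_derivable. Qed.

Lemma test_L2 eta : test_function Omega eta -> L2 Omega eta.
Proof.
move=> te; have [M eM] := test_cube te; have ce := smooth_continuous te.1.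
apply: (@L2_dominated _ _ _ _ (fun x => eta x ^+ 2)).
- by exists eta; [exact: continuous_measurable_rV|exact: ae_eq_refl].
- apply: (@integrable_continuous_compact_support _ _ M).
    by move=> x; exact: (continuousM (ce x) (ce x)).
  by move=> x /eM ->; rewrite expr0n.
- exact: aeW.
Qed.

(** The two integrands add up to the partial derivative of the product, which is
    compactly supported, and extending it by 0 outside [Omega] does not change its
    integral. *)
Lemma test_integration_by_parts i eta zeta : measurable Omega ->
  test_function Omega eta -> test_function Omega zeta ->
  \int[leb]_(x in Omega) (eta x * partial i zeta x) =
  - \int[leb]_(x in Omega) (partial i eta x * zeta x).
Proof.
move=> mO te tz; apply/eqP; rewrite -subr_eq0 opprK.
have [tpe tpz] := (test_partial i te, test_partial i tz).
rewrite -ae_RintegralD//; [|by apply: L2M_integrable => //; exact: test_L2..].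
have [M eM] := test_cube te.
have de := smooth_derivable te.1; have dz := smooth_derivable tz.1.
have pE : partial i (fun x => eta x * zeta x) =
    fun x => eta x * partial i zeta x + partial i eta x * zeta x.
  apply/funext => x; rewrite [partial i eta x * _]mulrC.
  exact: (deriveM (de i x) (dz i x)).
rewrite Rintegral_mkcond (_ : _ \_ _ = partial i (fun x => eta x * zeta x)); last first.
  rewrite pE; apply/funext => x; rewrite patchE; case: ifPn => // /negP xO.
  have Ox : ~ Omega x by move=> /mem_set.
  by rewrite (test_out te)// (test_out tz)// mul0r mulr0 addr0.
rewrite /Rintegral (@integral_partial _ _ i (fun x => eta x * zeta x) M)//.
- by move=> x; exact: (derivableM (de i x) (dz i x)).
- have ce := smooth_continuous te.1; have cz := smooth_continuous tz.1.
  have cpe := smooth_continuous tpe.1; have cpz := smooth_continuous tpz.1.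
  have c1 : continuous (fun x => eta x * partial i zeta x).
    by move=> x; exact: (continuousM (ce x) (cpz x)).
  have c2 : continuous (fun x => partial i eta x * zeta x).
    by move=> x; exact: (continuousM (cpe x) (cz x)).
  by rewrite pE => x; exact: (continuousD (c1 x) (c2 x)).
- by move=> x /eM ->; rewrite mul0r.
Qed.

End test_functions.

Section sobolev_spaces.
Context (R : realType) (d : nat) (Omega : set 'rV[R]_d).
Hypotheses (oO : open Omega) (bO : bounded_set Omega).
Local Notation leb := (lebesgue_rV R d).
Implicit Types (f g eta : 'rV[R]_d -> R) (i : 'I_d).

Let mO : measurable Omega. Proof. exact: open_measurable_rV. Qed.

(** Multiply by the constant 1, which is square integrable since a bounded set has
    finite measure. *)
Lemma L2_integrable f : L2 Omega f -> ae_integrable leb Omega f.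
Proof.
move=> Lf; have L1 : L2 Omega (fun=> 1).
  apply: (@L2_dominated _ _ _ _ \1_Omega).
  - by exists (cst 1) => //; exact: ae_eq_refl.
  - apply/integrableP; split; first by apply/measurable_EFinP; exact: measurable_indic.
    rewrite (eq_integral (fun x => (\1_Omega x)%:E)); last first.
      by move=> x _; rewrite gee0_abs// lee_fin.
    by rewrite integral_indic// setIT; exact: bounded_finite_measure.
  - by apply: aeW => x Ox; rewrite expr1n indicE mem_set.
rewrite (_ : f = fun x => f x * 1); first exact: L2M_integrable.
by apply/funext => x; rewrite mulr1.
Qed.

Lemma weak_partial_unique i f g h : L2 Omega g -> L2 Omega h ->
  is_weak_partial Omega i f g -> is_weak_partial Omega i f h -> ae_eq leb Omega g h.
Proof.
move=> Lg Lh wg wh.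
suff : ae_eq leb Omega (fun x => g x - h x) (fun=> 0).
  by apply: filterS => x + Ox => /(_ Ox) /eqP; rewrite subr_eq0 => /eqP.
apply: fundamental_lemma => //; first by apply: L2_integrable; exact: L2B.
move=> eta te; have Le := test_L2 te.
transitivity (\int[leb]_(x in Omega) (g x * eta x - h x * eta x)).
  by apply: eq_Rintegral => x _; rewrite mulrBl.
rewrite ae_RintegralB//; [|exact: L2M_integrable..].
by apply/eqP; rewrite subr_eq0 -eqr_opp -wg// wh.
Qed.

Lemma weak_partial_exists i f :
  (exists g, L2 Omega g /\ is_weak_partial Omega i f g) ->
  L2 Omega (weak_partial Omega i f) /\ is_weak_partial Omega i f (weak_partial Omega i f).
Proof. by move=> [g fg]; exact: (xgetPex (cst 0) (ex_intro [set g | L2 Omega g /\ is_weak_partial Omega i f g] g fg)). Qed.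

Lemma weak_partial_ae i f g : L2 Omega g -> is_weak_partial Omega i f g ->
  ae_eq leb Omega (weak_partial Omega i f) g.
Proof.
move=> Lg wg; have [Lw ww] := weak_partial_exists (ex_intro _ g (conj Lg wg)).
exact: weak_partial_unique ww wg.
Qed.

Lemma weak_partial_L2 f i : H1 Omega f -> L2 Omega (weak_partial Omega i f).
Proof. by move=> [_ /(_ i) /weak_partial_exists []]. Qed.

Lemma weak_partialP f i : H1 Omega f -> is_weak_partial Omega i f (weak_partial Omega i f).
Proof. by move=> [_ /(_ i) /weak_partial_exists []]. Qed.

Lemma test_is_weak_partial i eta : test_function Omega eta ->
  is_weak_partial Omega i eta (partial i eta).
Proof. by move=> te zeta tz; exact: test_integration_by_parts. Qed.

Lemma test_H1 eta : test_function Omega eta -> H1 Omega eta.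
Proof.
move=> te; split; first exact: test_L2.
move=> i; exists (partial i eta); split; last exact: test_is_weak_partial.
by apply: test_L2; exact: test_partial.
Qed.

Lemma weak_partial_test i eta : test_function Omega eta ->
  ae_eq leb Omega (weak_partial Omega i eta) (partial i eta).
Proof.
move=> te; apply: weak_partial_ae; last exact: test_is_weak_partial.
by apply: test_L2; exact: test_partial.
Qed.

Lemma test_H10 eta : test_function Omega eta -> H10 Omega eta.
Proof.
move=> te; split; first exact: test_H1.
move=> e e0; exists eta => //.
rewrite (_ : \int[leb]_(x in Omega) (eta x - eta x) ^+ 2 = 0) ?add0r.
  rewrite big1// => i _; rewrite -[RHS](Rintegral0 leb Omega).
  apply: ae_eq_Rintegral; have := weak_partial_test i te.
  by apply: filterS => x + Ox => ->//; rewrite subrr expr0n.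
rewrite -[RHS](Rintegral0 leb Omega); apply: eq_Rintegral => x _.
by rewrite subrr expr0n.
Qed.

Lemma is_weak_partialB i f g f' g' : L2 Omega f -> L2 Omega g ->
  L2 Omega f' -> L2 Omega g' ->
  is_weak_partial Omega i f f' -> is_weak_partial Omega i g g' ->
  is_weak_partial Omega i (fun x => f x - g x) (fun x => f' x - g' x).
Proof.
move=> Lf Lg Lf' Lg' wf wg eta te.
have Le := test_L2 te; have Lpe := test_L2 (test_partial i te).
under eq_Rintegral do rewrite mulrBl.
rewrite ae_RintegralB//; [|exact: L2M_integrable..].
rewrite wf// wg//.
under [in RHS]eq_Rintegral do rewrite mulrBl.
rewrite ae_RintegralB//; [|exact: L2M_integrable..].
by rewrite opprB opprK addrC.
Qed.

Lemma H1B f g : H1 Omega f -> H1 Omega g -> H1 Omega (fun x => f x - g x).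
Proof.
move=> Hf Hg; split; first exact: (L2B Hf.1 Hg.1).
move=> i; exists (fun x => weak_partial Omega i f x - weak_partial Omega i g x).
have [Lf Lg] := (weak_partial_L2 i Hf, weak_partial_L2 i Hg).
split; first exact: L2B.
by apply: is_weak_partialB (weak_partialP i Hf) (weak_partialP i Hg) => //; [exact: Hf.1|exact: Hg.1].
Qed.

Lemma weak_partialB i f g : H1 Omega f -> H1 Omega g ->
  ae_eq leb Omega (weak_partial Omega i (fun x => f x - g x))
    (fun x => weak_partial Omega i f x - weak_partial Omega i g x).
Proof.
move=> Hf Hg; have [Lf Lg] := (weak_partial_L2 i Hf, weak_partial_L2 i Hg).
apply: weak_partial_ae; first exact: L2B.
by apply: is_weak_partialB (weak_partialP i Hf) (weak_partialP i Hg) => //; [exact: Hf.1|exact: Hg.1].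
Qed.

Lemma ae_eq_is_weak_partial i f g h : ae_eq leb Omega f g ->
  is_weak_partial Omega i g h -> is_weak_partial Omega i f h.
Proof.
move=> fg wg eta te; rewrite -wg//; apply: ae_eq_Rintegral.
by apply: filterS fg => x + Ox => ->.
Qed.

Lemma ae_eq_H1 f g : ae_eq leb Omega f g -> H1 Omega g -> H1 Omega f.
Proof.
move=> fg [Lg wg]; split; first exact: ae_eq_L2 fg Lg.
by move=> i; have [h [Lh wh]] := wg i; exists h; split => //; exact: ae_eq_is_weak_partial wh.
Qed.

Lemma ae_eq_weak_partial i f g : ae_eq leb Omega f g -> H1 Omega g ->
  ae_eq leb Omega (weak_partial Omega i f) (weak_partial Omega i g).
Proof.
move=> fg Hg; apply: weak_partial_ae; first exact: weak_partial_L2.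
exact: ae_eq_is_weak_partial (weak_partialP i Hg).
Qed.

Lemma H2B f g : H2 Omega f -> H2 Omega g -> H2 Omega (fun x => f x - g x).
Proof.
move=> [Hf Hfi] [Hg Hgi]; split; first exact: H1B.
by move=> i; apply: ae_eq_H1 (weak_partialB i Hf Hg) _; exact: H1B.
Qed.

Lemma laplacianB f g : H2 Omega f -> H2 Omega g ->
  ae_eq leb Omega (laplacian Omega (fun x => f x - g x))
    (fun x => laplacian Omega f x - laplacian Omega g x).
Proof.
move=> [Hf Hfi] [Hg Hgi].
have : forall i, {ae leb, forall x, Omega x ->
   weak_partial Omega i (weak_partial Omega i (fun x => f x - g x)) x =
   weak_partial Omega i (weak_partial Omega i f) x - weak_partial Omega i (weak_partial Omega i g) x}.
  move=> i; apply: ae_eq_trans (weak_partialB i (Hfi i) (Hgi i)).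
  by apply: ae_eq_weak_partial (weak_partialB i Hf Hg) _; exact: H1B.
move=> /ae_forall_countable; apply: filterS => x fgx Ox.
by rewrite /laplacian -sumrB; apply: eq_bigr => i _; rewrite fgx.
Qed.

Lemma laplacian_L2 f : H2 Omega f -> L2 Omega (laplacian Omega f).
Proof. by move=> [_ Hf]; apply: L2_sum => i; exact: weak_partial_L2. Qed.

(** A substitute for the triangle inequality of the L^2 norm that avoids square
    roots, from (a - b)^2 + (a + b)^2 = 2 a^2 + 2 b^2. *)
Lemma sqrB_integral_le f g : L2 Omega f -> L2 Omega g ->
  \int[leb]_(x in Omega) (f x - g x) ^+ 2 <=
  2 * \int[leb]_(x in Omega) f x ^+ 2 + 2 * \int[leb]_(x in Omega) g x ^+ 2.
Proof.
move=> Lf Lg.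
have [If Ig] := (L2_sqr_integrable mO Lf, L2_sqr_integrable mO Lg).
rewrite -!ae_RintegralZ// -ae_RintegralD//; [|exact: ae_integrableZ..].
apply: ae_le_Rintegral => //.
- by apply: L2_sqr_integrable => //; exact: L2B.
- by apply: ae_integrableD => //; exact: ae_integrableZ.
- apply: aeW => x _; rewrite -subr_ge0.
  rewrite [leRHS](_ : _ = (f x + g x) ^+ 2); first exact: sqr_ge0.
  by ring.
Qed.

Lemma H10B f g : H10 Omega f -> H10 Omega g -> H10 Omega (fun x => f x - g x).
Proof.
move=> [Hf hf] [Hg hg]; split; first exact: H1B.
(* Each of the two approximation errors enters with the factor 2 of sqrB_integral_le. *)
move=> e e0; have e4 : 0 < e / 4 by rewrite divr_gt0.
have [ef tf If] := hf _ e4; have [eg tg Ig] := hg _ e4.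
exists (fun x => ef x - eg x); first exact: testB.
have [Lef Leg] := (test_L2 tf, test_L2 tg).
have Lpf i := test_L2 (test_partial i tf); have Lpg i := test_L2 (test_partial i tg).
have I0 : \int[leb]_(x in Omega) (f x - g x - (ef x - eg x)) ^+ 2 <=
    2 * \int[leb]_(x in Omega) (f x - ef x) ^+ 2 + 2 * \int[leb]_(x in Omega) (g x - eg x) ^+ 2.
  have := sqrB_integral_le (L2B Hf.1 Lef) (L2B Hg.1 Leg); apply: le_trans.
  rewrite le_eqVlt; apply/orP; left; apply/eqP; apply: eq_Rintegral => x _.
  by congr (_ ^+ 2); ring.
pose A i := \int[leb]_(x in Omega) (weak_partial Omega i f x - partial i ef x) ^+ 2.
pose B i := \int[leb]_(x in Omega) (weak_partial Omega i g x - partial i eg x) ^+ 2.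
have Ii i : \int[leb]_(x in Omega) (weak_partial Omega i (fun x => f x - g x) x -
      partial i (fun x => ef x - eg x) x) ^+ 2 <= 2 * A i + 2 * B i.
  have := sqrB_integral_le (L2B (weak_partial_L2 i Hf) (Lpf i)) (L2B (weak_partial_L2 i Hg) (Lpg i)).
  apply: le_trans; rewrite le_eqVlt; apply/orP; left; apply/eqP.
  apply: ae_eq_Rintegral; have := weak_partialB i Hf Hg.
  apply: filterS => x + Ox => ->//; rewrite (partialB _ tf.1 tg.1).
  by congr (_ ^+ 2); ring.
have {}If : \int[leb]_(x in Omega) (f x - ef x) ^+ 2 + \sum_(i < d) A i < e / 4 := If.
have {}Ig : \int[leb]_(x in Omega) (g x - eg x) ^+ 2 + \sum_(i < d) B i < e / 4 := Ig.
clearbody A B.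
have IS := ler_sum (index_enum 'I_d) (P := xpredT) (fun i _ => Ii i).
apply: (le_lt_trans (lerD I0 IS)).
have sumE : \sum_(i < d) (2 * A i + 2 * B i) = 2 * \sum_(i < d) A i + 2 * \sum_(i < d) B i.
  by rewrite big_split /= !mulr_sumr.
rewrite sumE; lra.
Qed.

Lemma H2H10B f g : H2H10 Omega f -> H2H10 Omega g -> H2H10 Omega (fun x => f x - g x).
Proof.
move=> [cf Hf H0f] [cg Hg H0g]; split; [|exact: H2B|exact: H10B].
by move=> x; exact: (continuousB (cf x) (cg x)).
Qed.

(** Holds by definition of the second weak derivatives, once the weak derivatives
    of the test function are replaced by the classical ones. *)
Lemma green_test f eta : H2 Omega f -> test_function Omega eta ->
  \int[leb]_(x in Omega) (\sum_(i < d) weak_partial Omega i f x * weak_partial Omega i eta x) =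
  - \int[leb]_(x in Omega) (laplacian Omega f x * eta x).
Proof.
move=> [Hf Hfi] te; have Le := test_L2 te; have He := test_H1 te.
rewrite ae_Rintegral_sum//; last first.
  by move=> i; apply: L2M_integrable => //; exact: weak_partial_L2.
rewrite /laplacian; under [in RHS]eq_Rintegral do rewrite mulr_suml.
rewrite ae_Rintegral_sum//; last first.
  by move=> i; apply: L2M_integrable => //; exact: weak_partial_L2.
rewrite -sumrN; apply: eq_bigr => i _.
rewrite -(weak_partialP i (Hfi i) te); apply: ae_eq_Rintegral.
by have := weak_partial_test i te; apply: filterS => x + Ox => ->.
Qed.

End sobolev_spaces.

(** * Convexity, mean values and the domain *)

Section one_variable.
Context (R : realType).
Implicit Types (f g : R -> R) (s t : R).
Local Notation deriv1 f := (derive1 (f : R -> R^o)).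

Lemma difference_quotient_cvg g t : derivable (g : R -> R^o) t 1 ->
  k.+1%:R * (g (t + k.+1%:R^-1) - g t) @[k --> \oo] --> deriv1 g t.
Proof.
move=> dg; rewrite derive1E.
have /cvgr_dnbhsP H : (fun h => h^-1 *: ((g \o shift t) (h *: (1 : R)) - g t)) h @[h --> (0 : R)^'] --> 'D_1 g t.
  exact: dg.
rewrite (_ : (fun k : nat => k.+1%:R * (g (t + k.+1%:R^-1) - g t)) =
    fun k : nat => (fun h => h^-1 *: ((g \o shift t) (h *: (1 : R)) - g t)) (k.+1%:R^-1)); last first.
  by apply/funext => k /=; rewrite invrK [_%:A]mulr1 [_ + t]addrC.
by apply: H; split; [move=> k; rewrite invr_eq0 pnatr_eq0|exact: cvg_harmonic].
Qed.

(** Convexity bounds the difference quotients of s |-> f(s + h (t - s)) at h = 0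
    by f(t) - f(s); take the limit along h = 1/(k+1). *)
Lemma convex_tangent (D : interval R) f s t :
  @convex_function R R^o [set` D] f -> derivable (f : R -> R^o) s 1 ->
  s \in D -> t \in D -> f s + deriv1 f s * (t - s) <= f t.
Proof.
move=> cf df sD tD.
pose g (h : R) := f (s + h * (t - s)).
have dg : is_derive (0 : R) (1 : R) (g : R -> R^o) (deriv1 f s * (t - s)).
  pose l (h : R) : R := (t - s) * h + s.
  have dl : is_derive (0 : R) (1 : R) l (t - s).
    have dl := is_deriveD (is_deriveZ (t - s) (is_derive_id (0 : R^o) 1)) (is_derive_cst (s : R^o) (0 : R^o) 1).
    by refine (@is_derive_eq _ _ _ _ _ _ _ _ dl _); rewrite addr0 [_%:A]mulr1.
  have dfl : is_derive (l 0) (1 : R) f (deriv1 f s).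
    by rewrite /l mulr0 add0r derive1E; exact: derivableP.
  have := @is_derive1_comp R f l 0 _ _ dfl dl.
  by rewrite (_ : f \o l = g)//; apply/funext => h; rewrite /g /l /= addrC mulrC.
have /difference_quotient_cvg : derivable (g : R -> R^o) 0 1 by case: dg.
rewrite derive1E; case: (dg) => _ ->.
rewrite -lerBrDl => gcv.
rewrite -(cvg_lim _ gcv)//; apply: limr_le; first by apply/cvg_ex; exists (deriv1 f s * (t - s)).
apply: nearW => k; rewrite add0r /g mul0r addr0.
have k0 : 0 < k.+1%:R :> R by rewrite ltr0Sn.
have h0 : 0 <= k.+1%:R^-1 :> R by rewrite invr_ge0 ltW.
have h1 : k.+1%:R^-1 <= 1 :> R by rewrite invf_le1// ler1n.
have := cf (Itv01 h0 h1) t s.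
rewrite !inE/= => /(_ tD sD); rewrite !convRE /= => cfk.
have {}cfk : f (k.+1%:R^-1 * t + (1 - k.+1%:R^-1) * s) <=
    k.+1%:R^-1 * f t + (1 - k.+1%:R^-1) * f s := cfk.
rewrite mulrC -ler_pdivlMr// lerBlDr.
have -> : s + k.+1%:R^-1 * (t - s) = k.+1%:R^-1 * t + (1 - k.+1%:R^-1) * s by ring.
by apply: (le_trans cfk); rewrite le_eqVlt; apply/orP; left; apply/eqP; field; rewrite gt_eqF.
Qed.

Lemma mean_value_bound f (c t : R) : 0 <= c ->
  (forall s, derivable (f : R -> R^o) s 1) -> f 0 = 0 ->
  (forall s, `|s| <= `|t| -> 0 <= deriv1 f s <= c) -> `|f t| <= c * `|t|.
Proof.
move=> c0 df f0 fc.
have cf : continuous f by move=> s; apply/differentiable_continuous/derivable1_diffP.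
have dfE s : is_derive s (1 : R) f (deriv1 f s) by rewrite derive1E; exact: derivableP.
have [t0|t0] := leP 0 t.
  have [|s sI] := @MVT_segment R f (deriv1 f) 0 t t0 (fun s _ => dfE s).
    exact: continuous_subspaceT.
  rewrite f0 !subr0 => ->; rewrite normrM ler_wpM2r//.
  move: sI; rewrite in_itv /= => /andP[s0 st].
  have /fc/andP[h1 h2] : `|s| <= `|t| by rewrite !ger0_norm.
  by rewrite ger0_norm.
have [|s sI] := @MVT_segment R f (deriv1 f) t 0 (ltW t0) (fun s _ => dfE s).
  exact: continuous_subspaceT.
rewrite f0 !sub0r mulrN => /oppr_inj ->; rewrite normrM ler_wpM2r//.
move: sI; rewrite in_itv /= => /andP[st s0].
have /fc/andP[h1 h2] : `|s| <= `|t| by rewrite !ler0_norm ?lerN2// ltW.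
by rewrite ger0_norm.
Qed.

End one_variable.

Section domain.
Context (R : realType) (d : nat).

Lemma polyhedral_open (Omega : set 'rV[R]_d) : convex_polyhedral_domain Omega -> open Omega.
Proof.
move=> [_ _ [m [a [b ->]]]].
rewrite [X in open X](_ : _ = ~` \bigcup_(k in [set: 'I_m])
    [set x : 'rV[R]_d | b k <= \sum_(j < d) a k 0 j * x 0 j]); last first.
  apply/seteqP; split => [x h [k _ /=]|x h k]; first by rewrite leNgt h.
  by rewrite ltNge; apply/negP => bk; apply: h; exists k.
apply: closed_openC; apply: closed_bigcup => [|k _]; first exact: finite_finset.
have cl : continuous (fun x : 'rV[R]_d => \sum_(j < d) a k 0 j * x 0 j).
  elim: (index_enum 'I_d) => [|j s IH].
    by rewrite (_ : (fun _ => _) = fun=> 0); [exact: cst_continuous|apply/funext => x; rewrite big_nil].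
  rewrite (_ : (fun _ => _) = fun x : 'rV[R]_d => a k 0 j * x 0 j + \sum_(j <- s) a k 0 j * x 0 j); last first.
    by apply/funext => x; rewrite big_cons.
  have cj : continuous (fun x : 'rV[R]_d => a k 0 j * x 0 j).
    have c1 : continuous (fun _ : 'rV[R]_d => a k 0 j) by exact: cst_continuous.
    have c2 : continuous (fun x : 'rV[R]_d => x 0 j) by move=> x; exact: coord_continuous.
    by move=> x; exact: (continuousM (c1 x) (c2 x)).
  by move=> x; exact: (continuousD (cj x) (IH x)).
apply: (@preimage_closed _ _ (fun x : 'rV[R]_d => \sum_(j < d) a k 0 j * x 0 j) [set t | b k <= t]).
  by move=> x _; exact: cl.
exact: closed_ge.
Qed.

Lemma continuous_closure_bounded (Omega : set 'rV[R]_d) (f : 'rV[R]_d -> R) :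
  bounded_set Omega -> {within closure Omega, continuous f} ->
  exists2 L, 0 <= L & forall x, Omega x -> `|f x| <= L.
Proof.
move=> bO cf; have [M OM] := bounded_sub_cube bO.
have cO : compact (closure Omega).
  apply: (subclosed_compact _ (@cbox_compact R d (const_mx (- M)) (const_mx M))).
    exact: closed_closure.
  by rewrite -/(cube d M) [X in _ `<=` X](closure_id _).1; [exact: closure_subset|exact: closed_cube].
have := continuous_compact cf cO.
move=> /(@compact_bounded _ R^o) [N [Nr NP]]; exists (`|N| + 1); first by rewrite addr_ge0.
move=> x Ox; apply: (NP (`|N| + 1)); first by rewrite (le_lt_trans (ler_norm N))// ltrDl.
by exists x => //; exact: subset_closure.
Qed.

End domain.

(** * The control problem *)

Section control_problem_theory.
Context (R : realType) (d : nat) (pb : problem R d).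
Hypothesis Hpb : standing_assumptions pb.
Local Notation leb := (lebesgue_rV R d).
Local Notation Omega := (Omega pb).
Local Notation phi := (phi pb).
Local Notation phi_y := (phi_y pb).
Local Notation y0 := (y0 pb).
Local Notation alpha := (alpha pb).
Implicit Types (u v y z p w : 'rV[R]_d -> R).

Lemma Omega_open : open Omega.
Proof. by case: Hpb => /polyhedral_open. Qed.

Lemma Omega_bounded : bounded_set Omega.
Proof. by case: Hpb => -[]. Qed.

Let oO := Omega_open.
Let bO := Omega_bounded.
Let mO : measurable Omega. Proof. exact: open_measurable_rV. Qed.

Lemma H2H10_L2 y : H2H10 Omega y -> L2 Omega y.
Proof. by move=> [_ [[]]]. Qed.

Lemma phi_continuous : {ae leb, forall x, Omega x -> continuous (phi x)}.
Proof.
have := phi_C1 Hpb; apply: filterS => x h /h [df _] t.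
by apply/differentiable_continuous/derivable1_diffP.
Qed.

Lemma superposition_measurable y : L2 Omega y ->
  lebesgue_measurable_fun Omega (fun x => phi x (y x)).
Proof.
move=> Ly; apply: (@superposition_lebesgue_measurable _ _ _ phi y); [exact: phi_measurable Hpb|exact: phi_continuous|].
exact: L2_measurable.
Qed.

(** [y] is continuous on the compact closure of [Omega], hence bounded, so the
    local bound on the derivative of [phi] is uniform along [y].  As [phi] vanishes
    at 0, the mean value theorem then bounds [phi x (y x)] by a multiple of
    [y x]. *)
Lemma superposition_L2 y : H2H10 Omega y -> L2 Omega (fun x => phi x (y x)).
Proof.
move=> Hy; have Ly := H2H10_L2 Hy; have [cy _ _] := Hy.
have [L L0 yL] := continuous_closure_bounded bO cy.
have [c c0 phic] := phi_y_bounded Hpb L0.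
apply: (L2_le (g := fun x => c * y x)); [exact: superposition_measurable|exact: L2Z|].
have H := ae_and (ae_and (phi_C1 Hpb) (phi_0 Hpb)) (ae_and (phi_y_ge0 Hpb) phic).
apply: filterS H => x [[h1 h2] [h3 h4]] Ox; have [df _] := h1 Ox.
rewrite normrM (ger0_norm c0); apply: mean_value_bound => //; first exact: h2.
move=> s sy; apply/andP; split; first exact: h3.
by apply: h4 => //; exact: le_trans sy (yL x Ox).
Qed.

(** Boundedness is as in [superposition_L2]; measurability comes from writing the
    derivative as a limit of difference quotients of superpositions. *)
Lemma phi_y_superposition_L2 y w : H2H10 Omega y -> L2 Omega w ->
  L2 Omega (fun x => phi_y x (y x) * w x).
Proof.
move=> Hy Lw; have Ly := H2H10_L2 Hy; have [cy _ _] := Hy.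
have [L L0 yL] := continuous_closure_bounded bO cy.
have [c c0 phic] := phi_y_bounded Hpb L0.
apply: (L2_le (g := fun x => c * w x)); last first.
- have := ae_and (phi_y_ge0 Hpb) phic.
  apply: filterS => x [h1 h2] Ox; rewrite !normrM ler_wpM2r//.
  rewrite (ger0_norm (h1 Ox _)) (ger0_norm c0); apply: h2 => //.
  exact: yL.
- exact: L2Z.
apply: lebesgue_measurable_funM; last exact: L2_measurable.
apply: (@lebesgue_measurable_fun_lim _ _ _
  (fun k x => k.+1%:R * (phi x (y x + k.+1%:R^-1) - phi x (y x)))).
  move=> k; apply: lebesgue_measurable_funM.
    by exists (cst k.+1%:R) => //; exact: ae_eq_refl.
  apply: lebesgue_measurable_funD.
    apply: (@superposition_lebesgue_measurable _ _ _ phi (fun x => y x + k.+1%:R^-1)); [exact: phi_measurable Hpb|exact: phi_continuous|].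
    apply: lebesgue_measurable_funD; first exact: L2_measurable.
    by exists (cst k.+1%:R^-1) => //; exact: ae_eq_refl.
  apply: (@lebesgue_measurable_fun_comp _ _ _ (fun x => phi x (y x)) -%R).
    exact: oppr_measurable.
  exact: superposition_measurable.
have := phi_C1 Hpb; apply: filterS => x h /h [df _].
exact: difference_quotient_cvg.
Qed.

(** Test the weak state equation with test functions, move the derivatives back
    onto [y], and apply the fundamental lemma to the residual of the equation. *)
Lemma first_order_state u y p mu : first_order_system pb u y p mu -> state pb u y.
Proof.
move=> HS; split; first exact: fos_y HS.
have Hy := fos_y HS; have [cy H2y H10y] := Hy; have Lu := (fos_u HS).1.
have Lphi := superposition_L2 Hy; have LD := laplacian_L2 H2y.
pose h x := - laplacian Omega y x + phi x (y x) - u x.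
have Lh : L2 Omega h by apply: L2B => //; apply: L2D => //; exact: L2N.
suff : ae_eq leb Omega h (fun=> 0).
  by apply: filterS => x + Ox => /(_ Ox) /eqP; rewrite subr_eq0 => /eqP.
apply: fundamental_lemma => //; first exact: L2_integrable.
move=> eta te; have Le := test_L2 te; have He := test_H10 oO bO te.
have IL := L2M_integrable mO LD Le; have Iphi := L2M_integrable mO Lphi Le.
have Iu := L2M_integrable mO Lu Le.
transitivity (\int[leb]_(x in Omega)
    (- (laplacian Omega y x * eta x) + phi x (y x) * eta x - u x * eta x)).
  by apply: eq_Rintegral => x _; rewrite /h; ring.
have INL := ae_integrableN mO IL.
rewrite ae_RintegralB//; last exact: ae_integrableD.
rewrite ae_RintegralD// ae_RintegralN//.
rewrite -(green_test oO bO H2y te) -(fos_state HS He).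
rewrite ae_RintegralD// ?subrr//.
apply: ae_integrable_sum => // i; apply: L2M_integrable => //.
  by apply: weak_partial_L2; case: H2y.
by apply: weak_partial_L2; case: He.
Qed.

(** In the concave case the tangent inequality is applied to [- phi x]. *)
Lemma tangent_sign (I : interval R) p y z :
  (phi_convex_on pb I /\ {ae leb, forall x, Omega x -> p x <= 0}) \/
  (phi_concave_on pb I /\ {ae leb, forall x, Omega x -> 0 <= p x}) ->
  (forall x, Omega x -> y x \in I) -> (forall x, Omega x -> z x \in I) ->
  {ae leb, forall x, Omega x ->
    p x * (phi x (z x) - phi x (y x) - phi_y x (y x) * (z x - y x)) <= 0}.
Proof.
move=> [] [cphi p0] yI zI.
  have := ae_and (phi_C1 Hpb) (ae_and cphi p0).
  apply: filterS => x [h1 [h2 h3]] Ox; have [df _] := h1 Ox.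
  have := convex_tangent (h2 Ox) (df (y x)) (yI x Ox) (zI x Ox).
  rewrite -/(Defs.phi_y pb x (y x)) => T; apply: mulr_le0_ge0; first exact: h3.
  by rewrite -addrA -opprD subr_ge0.
have := ae_and (phi_C1 Hpb) (ae_and cphi p0).
apply: filterS => x [h1 [h2 h3]] Ox; have [df _] := h1 Ox.
have dN : is_derive (y x) (1 : R) (fun t => - phi x t : R^o) (- phi_y x (y x)).
  by rewrite /Defs.phi_y derive1E; apply: is_deriveN; exact: derivableP.
have := convex_tangent (h2 Ox) (let: DeriveDef a _ := dN in a) (yI x Ox) (zI x Ox).
rewrite derive1E; case: dN => _ -> T.
by apply: mulr_ge0_le0; [exact: h3|lra].
Qed.

Lemma cost_expansion u y v z : L2 Omega u -> L2 Omega y -> L2 Omega v -> L2 Omega z ->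
  J pb v z - J pb u y =
    \int[leb]_(x in Omega) ((y x - y0 x) * (z x - y x)) +
    2^-1 * \int[leb]_(x in Omega) (z x - y x) ^+ 2 +
    alpha * \int[leb]_(x in Omega) (u x * (v x - u x)) +
    alpha / 2 * \int[leb]_(x in Omega) (v x - u x) ^+ 2.
Proof.
move=> Lu Ly Lv Lz; have Ly0 := y0_L2 Hpb.
have sqrE (f g : 'rV[R]_d -> R) : L2 Omega f -> L2 Omega g ->
    \int[leb]_(x in Omega) (g x) ^+ 2 = \int[leb]_(x in Omega) (f x) ^+ 2 +
    (2 * \int[leb]_(x in Omega) (f x * (g x - f x)) + \int[leb]_(x in Omega) (g x - f x) ^+ 2).
  move=> Lf Lg; have Lgf := L2B Lg Lf.
  have Ifg := L2M_integrable mO Lf Lgf.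
  have [If Igf] := (L2_sqr_integrable mO Lf, L2_sqr_integrable mO Lgf).
  rewrite -ae_RintegralZ// -!ae_RintegralD//.
  - by apply: eq_Rintegral => x _; ring.
  - by apply: ae_integrableD => //; exact: ae_integrableZ.
  - exact: ae_integrableZ.
rewrite /J (sqrE u v)// (sqrE (fun x => y x - y0 x) (fun x => z x - y0 x)); [|exact: L2B..].
have -> : \int[leb]_(x in Omega) ((y x - y0 x) * (z x - y0 x - (y x - y0 x))) =
    \int[leb]_(x in Omega) ((y x - y0 x) * (z x - y x)).
  by apply: eq_Rintegral => x _; ring.
have -> : \int[leb]_(x in Omega) (z x - y0 x - (y x - y0 x)) ^+ 2 =
    \int[leb]_(x in Omega) (z x - y x) ^+ 2.
  by apply: eq_Rintegral => x _; ring.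
by field.
Qed.

(** The adjoint equation tested with z - y, whose Laplacian is eliminated by means
    of the two state equations. *)
Lemma adjoint_identity u y p mu v z : first_order_system pb u y p mu ->
  H2H10 Omega z -> L2 Omega v -> state pb u y -> state pb v z ->
  \int[leb]_(x in Omega) ((y x - y0 x) * (z x - y x)) +
    charge_integral mu (K pb) (fun x => z x - y x) =
  \int[leb]_(x in Omega) (p x * (v x - u x)) -
  \int[leb]_(x in Omega)
    (p x * (phi x (z x) - phi x (y x) - phi_y x (y x) * (z x - y x))).
Proof.
move=> HS Hz Lv [Hy Su] [_ Sv].
have Hw := H2H10B oO bO Hz Hy.
have Lu := (fos_u HS).1; have Lp := fos_p HS.
have [Ly Lz] := (H2H10_L2 Hy, H2H10_L2 Hz).
have Lw := L2B Lz Ly; have Ls := L2B Lv Lu.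
have LT : L2 Omega (fun x => phi x (z x) - phi x (y x) - phi_y x (y x) * (z x - y x)).
  apply: L2B; last exact: phi_y_superposition_L2.
  by apply: L2B; exact: superposition_L2.
rewrite -(fos_adjoint HS Hw) -ae_RintegralB//; [|exact: L2M_integrable..].
apply: ae_eq_Rintegral.
have [_ H2y _] := Hy; have [_ H2z _] := Hz.
have := ae_and (laplacianB oO bO H2z H2y) (ae_and Su Sv).
apply: filterS => x [h1 [h2 h3]] Ox; rewrite h1// -(h2 Ox) -(h3 Ox).
move: (laplacian Omega y x) (laplacian Omega z x) (phi x (y x)) (phi x (z x)).
by move: (phi_y x (y x)) (p x) (y x) (z x) => a b c e f g h k; ring.
Qed.

(** All terms of the expanded cost difference other than the squared distance of
    the controls are nonnegative: the variational inequality, the multiplier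
    inequality and the tangent inequality each account for one of them. *)
Lemma quadratic_growth (I : interval R) u y p mu v z :
  first_order_system pb u y p mu -> feasible pb u y -> feasible pb v z ->
  (phi_convex_on pb I /\ {ae leb, forall x, Omega x -> p x <= 0}) \/
  (phi_concave_on pb I /\ {ae leb, forall x, Omega x -> 0 <= p x}) ->
  (forall x, Omega x -> y x \in I) -> (forall x, Omega x -> z x \in I) ->
  alpha / 2 * \int[leb]_(x in Omega) (v x - u x) ^+ 2 <= J pb v z - J pb u y.
Proof.
move=> HS [Uu Su Cu] [Uv Sv Cv] Hp yI zI.
have [[Lu _] [Lv _]] := (Uu, Uv); have Lp := fos_p HS.
have [[Hy _] [Hz _]] := (Su, Sv).
have [Ly Lz] := (H2H10_L2 Hy, H2H10_L2 Hz).
have Lw := L2B Lz Ly; have Ls := L2B Lv Lu.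
have KO : K pb `<=` closure Omega.
  case: (K_position Hpb) => [KO|->//].
  exact: subset_trans KO (@subset_closure _ _).
have mult : charge_integral mu (K pb) (fun x => z x - y x) <= 0.
  apply: (fos_multiplier HS) => //.
  by case: Hz => cz _ _; exact: continuous_subspaceW cz.
have sign : \int[leb]_(x in Omega)
    (p x * (phi x (z x) - phi x (y x) - phi_y x (y x) * (z x - y x))) <= 0.
  rewrite -oppr_ge0; have LT : L2 Omega (fun x => phi x (z x) - phi x (y x) - phi_y x (y x) * (z x - y x)).
    apply: L2B; last exact: phi_y_superposition_L2.
    by apply: L2B; exact: superposition_L2.
  rewrite -ae_RintegralN//; last exact: L2M_integrable.
  apply: ae_ge0_Rintegral; apply: filterS (tangent_sign Hp yI zI) => x + Ox.
  by rewrite oppr_ge0; exact.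
have var : 0 <= \int[leb]_(x in Omega) (p x * (v x - u x)) +
    alpha * \int[leb]_(x in Omega) (u x * (v x - u x)).
  rewrite -ae_RintegralZ//; last exact: L2M_integrable.
  rewrite -ae_RintegralD//; [|exact: L2M_integrable|by apply: ae_integrableZ => //; exact: L2M_integrable].
  have := fos_control HS Uv; rewrite (_ : Rintegral _ _ _ = \int[leb]_(x in Omega)
     (p x * (v x - u x) + alpha * (u x * (v x - u x))))//.
  by apply: eq_Rintegral => x _; ring.
have sq : 0 <= \int[leb]_(x in Omega) (z x - y x) ^+ 2.
  by apply: Rintegral_ge0 => x _; exact: sqr_ge0.
have adj := adjoint_identity HS Hz Lv Su Sv.
rewrite (cost_expansion Lu Ly Lv Lz).
lra.
Qed.

End control_problem_theory.

Unset Implicit Arguments.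

Theorem theorem2p1 (R : realType) (d : nat) (d23 : d = 2%N \/ d = 3%N)
  (pb : problem R d) (Hpb : standing_assumptions pb)
  (u y p : 'rV[R]_d -> R) (mu : {charge set 'rV[R]_d -> \bar R})
  (HS : first_order_system pb u y p mu)
  (I : interval R)
  (HI : forall v z : 'rV[R]_d -> R, Uad pb v -> state pb v z ->
    state_constraints pb z -> forall x, Omega pb x -> z x \in I)
  (Hp : (phi_convex_on pb I /\
         {ae lebesgue_rV R d, forall x, Omega pb x -> p x <= 0}) \/
        (phi_concave_on pb I /\
         {ae lebesgue_rV R d, forall x, Omega pb x -> 0 <= p x})) :
  unique_global_minimum pb u.
Proof.
have Su := first_order_state Hpb HS.
have Fu : feasible pb u y by split; [exact: fos_u HS|exact: Su|exact: fos_constraints HS].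
have inI v z : feasible pb v z -> forall x, Omega pb x -> z x \in I.
  by move=> [Uv Sv Cv]; exact: (HI v z Uv Sv Cv).
have a0 : 0 < alpha pb by exact: alpha_gt0 Hpb.
have growth v z (Fv : feasible pb v z) :=
  quadratic_growth Hpb HS Fu Fv Hp (inI _ _ Fu) (inI _ _ Fv).
split.
  exists y => // v z /growth Jle; rewrite -subr_ge0; apply: le_trans Jle.
  apply: mulr_ge0; first by rewrite divr_ge0// ltW.
  by apply: Rintegral_ge0 => x _; exact: sqr_ge0.
move=> v [z Fv /(_ _ _ Fu) Jvu].
have mO : measurable (Omega pb) by apply: open_measurable_rV; exact: Omega_open.
have Lvu : L2 (Omega pb) (fun x => v x - u x).
  by apply: L2B; [case: Fv => -[]|case: Fu => -[]].
have : ae_eq (lebesgue_rV R d) (Omega pb) (fun x => (v x - u x) ^+ 2) (fun=> 0).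
  apply: ae_Rintegral_eq0 => //; first exact: L2_sqr_integrable.
    by apply: aeW => x _; exact: sqr_ge0.
  have : alpha pb / 2 * \int[lebesgue_rV R d]_(x in Omega pb) (v x - u x) ^+ 2 <= 0.
    by apply: le_trans (growth _ _ Fv) _; rewrite subr_le0.
  by rewrite pmulr_rle0// divr_gt0.
by apply: filterS => x + Ox => /(_ Ox) /eqP; rewrite sqrf_eq0 subr_eq0 => /eqP.
Qed.
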